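(* Let $\alpha\in(0,1)$ and $\theta>-\alpha$, and let $n\ge1$ and $1\le k\le n$ be integers. Let $H=Y_1X$, where $Y_1$ and $X$ are independent random variables, $Y_1$ has density $g_{\alpha,\theta+n}$ and $X\sim\mathrm{Beta}(\theta/\alpha+k,\;n/\alpha-k)$. Let $Z_{n,k}^{\alpha,\theta}$ be a random variable with density $f_{\alpha,\theta}^{n,k}$ on $(0,\infty)$. Then $Z_{n,k}^{\alpha,\theta}$ and $H$ have the same characteristic function, namely $$ G_{\alpha,\theta}^{n,k}(t)=\sum_{r\ge0}\frac{(it)^r}{r!}\left(\frac{\theta+k\alpha}{\alpha}\right)_r\frac{1}{(\theta+n)_{r\alpha}},\qquad t\in\mathbb{R}. $$
   Context: Notation: $(x)_s=\Gamma(x+s)/\Gamma(x)$ for $x>0$ and real $s\ge0$ (for integer $s$ this is the rising factorial $x(x+1)\cdots(x+s-1)$). $f_\alpha$ denotes the density on $(0,\infty)$ of the positive $\alpha$-stable random variable, with Laplace transform $\int_0^\infty e^{-\lambda x}f_\alpha(x)\,dx=e^{-\lambda^\alpha}$, $\lambda\ge0$. The Mittag-Leffler density is $g_\alpha(z)=\alpha^{-1}z^{-1-1/\alpha}f_\alpha(z^{-1/\alpha})$ for $z>0$, and for $\eta>-\alpha$ $$ g_{\alpha,\eta}(z)=\frac{\Gamma(\eta+1)}{\Gamma(\eta/\alpha+1)}\,z^{\eta/\alpha}\,g_\alpha(z),\qquad z>0. $$ The density $f_{\alpha,\theta}^{n,k}$ is, for $z>0$, $$ f_{\alpha,\theta}^{n,k}(z)=\frac{\Gamma(\theta+n)}{\Gamma(\theta/\alpha+k)\,\Gamma(n-k\alpha)\,\alpha}\;z^{\theta/\alpha+k-1}\int_z^\infty\big(1-(z/v)^{1/\alpha}\big)^{n-k\alpha-1}f_\alpha(v^{-1/\alpha})\,v^{-1/\alpha-1}\,dv.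 $$ ($Z_{n,k}^{\alpha,\theta}$ is the almost sure limit, conditionally on $K_n=k$, of $m^{-\alpha}$ times the number of new species in an additional $m$-sample under the two-parameter $(\alpha,\theta)$ Poisson-Dirichlet partition model, where $K_n$ is the number of distinct species in the basic $n$-sample; only its density is needed here.) *)

(* Defs.v *)
From HB Require Import structures.
From mathcomp Require Import all_boot all_order all_algebra.
From mathcomp Require Import all_classical all_reals all_analysis.
From mathcomp Require Import complex.

Set Implicit Arguments.
Unset Strict Implicit.
Unset Printing Implicit Defensive.

Import Order.TTheory GRing.Theory Num.Theory.
Import numFieldNormedType.Exports.

Local Open Scope classical_set_scope.
Local Open Scope ring_scope.
Local Open Scope complex_scope.

Section special_functions.
Context {R : realType}.
Local Notation mu := (@lebesgue_measure R).

(* Euler's integrals; only meaningful for positive arguments. *)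
Definition Gamma (x : R) : R :=
  \int[mu]_(t in `]0, +oo[) (t `^ (x - 1) * expR (- t)).

Definition Beta (a b : R) : R :=
  \int[mu]_(t in `]0, 1[) (t `^ (a - 1) * (1 - t) `^ (b - 1)).

(* The Pochhammer symbol (x)_s, with a real index s. *)
Definition poch (x s : R) : R := Gamma (x + s) / Gamma x.

End special_functions.

Section densities.
Context {R : realType}.
Local Notation mu := (@lebesgue_measure R).

(* f is a density, on the half-line, of the positive alpha-stable law. Only
   the values of f on ]0, +oo[ matter, and any version of the density is
   allowed. The total mass is 1 by the case lam = 0, as 0 `^ alpha = 0. *)
Definition stable_density (alpha : R) (f : R -> R) : Prop :=
  [/\ measurable_fun (`]0, +oo[ : set R) f,
      forall x, 0 < x -> 0 <= f x &
      forall lam : R, 0 <= lam ->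
        (\int[mu]_(x in `]0%R, +oo[) (expR (- (lam * x)) * f x)%:E
         = (expR (- (lam `^ alpha)))%:E)%E].

(* Here, and in gML_density and Z_density, f stands for a stable_density of
   index alpha. *)
Definition ML_density (alpha : R) (f : R -> R) (z : R) : R :=
  alpha^-1 * z `^ (- 1 - alpha^-1) * f (z `^ (- alpha^-1)).

Definition gML_density (alpha eta : R) (f : R -> R) (z : R) : R :=
  Gamma (eta + 1) / Gamma (eta / alpha + 1) * z `^ (eta / alpha)
  * ML_density alpha f z.

Definition Z_density (alpha theta : R) (n k : nat) (f : R -> R) (z : R) : R :=
  Gamma (theta + n%:R)
    / (Gamma (theta / alpha + k%:R) * Gamma (n%:R - k%:R * alpha) * alpha)
  * z `^ (theta / alpha + k%:R - 1)
  * \int[mu]_(v in `]z, +oo[)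
      ((1 - (z / v) `^ (alpha^-1)) `^ (n%:R - k%:R * alpha - 1)
       * f (v `^ (- alpha^-1)) * v `^ (- alpha^-1 - 1)).

Definition Beta_density (a b x : R) : R :=
  x `^ (a - 1) * (1 - x) `^ (b - 1) / Beta a b.

End densities.

Section random_variables.
Context {R : realType} d {T : measurableType d} {P : probability T R}.
Local Notation mu := (@lebesgue_measure R).

(* The law of X is carried by D and has density f there; the values of f
   outside D are irrelevant. *)
Definition has_density_on (D : set R) (X : {RV P >-> R}) (f : R -> R) : Prop :=
  [/\ measurable_fun D f,
      forall x, D x -> 0 <= f x &
      forall A, measurable A ->
        (distribution P X A = \int[mu]_(x in A `&` D) (f x)%:E)%E].

Definition independent_RV (X Y : {RV P >-> R}) : Prop :=
  forall A B : set R, measurable A -> measurable B ->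
    (P (X @^-1` A `&` Y @^-1` B) = P (X @^-1` A) * P (Y @^-1` B))%E.

End random_variables.

(* E[exp(itX)], with exp(iy) = cos y + i sin y. Both expectations are finite
   when X is measurable. *)
Definition char_fun (R : realType) d (T : measurableType d)
    (P : probability T R) (X : T -> R) (t : R) : R[i] :=
  fine 'E_P[fun w => cos (t * X w)] +i* fine 'E_P[fun w => sin (t * X w)].

Definition G_term (R : realType) (alpha theta : R) (n k : nat) (t : R)
    (r : nat) : R[i]^o :=
  ('i%C * t%:C) ^+ r / (r`!)%:R
  * (poch ((theta + k%:R * alpha) / alpha) r%:R)%:C
  * ((poch (theta + n%:R) (r%:R * alpha))^-1)%:C.

(* R[i]^o carries the topology of the complex modulus. *)
Definition G_fun (R : realType) (alpha theta : R) (n k : nat) (t : R) : R[i]^o :=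
  lim (series (G_term alpha theta n k t) @ \oo).

(* Main.v *)
Require Import Defs.
From HB Require Import structures.
From mathcomp Require Import all_boot all_order all_algebra.
From mathcomp Require Import all_classical all_reals all_analysis.
From mathcomp Require Import complex measurable_realfun.
From mathcomp Require Import ring lra.

(* Write a = theta / alpha + k and eta = theta + n. Both laws have r-th moment
   (a)_r / (eta)_(r alpha). For the positive stable variable S, integrating the
   Laplace transform exp(- l ^ alpha) against l ^ (s - 1) yields, by Tonelli,
   E[S ^ (- s)] = Gamma (s / alpha) / (alpha Gamma s) for s > 0. The moments of
   Y1 are such negative moments after z = x ^ (- alpha), those of X are quotients
   of Beta integrals, and those of Z follow from Tonelli and the substitution
   u = (z / v) ^ (1 / alpha) in the inner integral. Since Gamma x / Gamma (x +
   alpha) tends to 0, the sum of |t| ^ r E[H ^ r] / r! is finite, so that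
   E[cos (t H)] and E[sin (t H)] may be expanded termwise. *)

Set Implicit Arguments.
Unset Strict Implicit.
Unset Printing Implicit Defensive.

Import Order.TTheory GRing.Theory Num.Theory.
Import numFieldNormedType.Exports.

Local Open Scope classical_set_scope.
Local Open Scope ring_scope.

(** Integrals of nonnegative functions are kept in the extended reals and over the whole line, with
    integrands extended by zero, so that Tonelli and the changes of variables apply before
    finiteness is known. A power substitution x -> c x ^ p is affine in the coordinate y = ln x. All
    of them, negative exponents included, thus reduce to affine maps and to the image of Lebesgue
    measure under exp.

    In the moments of H = Y1 X, the factor Gamma ((theta + n) / alpha + r) contributed by Y1 cancels
    against the denominator contributed by X, because the two Beta parameters add up to (theta + n)
    / alpha.

    The ratio of consecutive terms of the moment series is |t| (a + r) / (r + 1) times a quotient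
    Gamma x / Gamma (x + alpha). The decay of this quotient is obtained from a pointwise inequality
    under the Gamma integral, not from an asymptotic formula. The sum of the series is
    E[exp (|t| H)], which makes the exponential a common integrable bound for all partial sums of
    the cosine and sine series. *)

Section density.
Context d (T : measurableType d) (R : realType).
Variable mu : {measure set T -> \bar R}.
Variable g : T -> R.
Hypothesis mg : measurable_fun [set: T] g.
Hypothesis g0 : forall x, 0 <= g x.
Local Open Scope ereal_scope.

Import HBNNSimple.

(** The hypothesis on [m] is the case of an indicator [h]; linearity extends it to simple functions,
    and monotone convergence along [nnsfun_approx] to every nonnegative measurable [h]. Only the
    values of [m] enter, so [m] may be the law of a random variable as well as a measure built from
    [g]. *)
Lemma ge0_integral_density d' (T' : measurableType d')
    (m : {measure set T' -> \bar R}) (phi : T -> T') (h : T' -> \bar R) :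
  measurable_fun [set: T] phi ->
  (forall A, measurable A -> m A = \int[mu]_(x in phi @^-1` A) (g x)%:E) ->
  measurable_fun [set: T'] h -> (forall x, 0 <= h x) ->
  \int[m]_x h x = \int[mu]_x (h (phi x) * (g x)%:E).
Proof.
move=> mphi mE mh h0; have mg' : measurable_fun [set: T] (EFin \o g).
  exact/measurable_EFinP.
pose h_ := nnsfun_approx measurableT mh.
have h_cvg x : (EFin \o h_ ^~ x) @ \oo --> h x.
  by apply: cvg_nnsfun_approx.
have h_nd x : {homo (fun n => (h_ n x)%:E) : a b / (a <= b)%N >-> a <= b}.
  by move=> a b ab; rewrite lee_fin; apply/lefP/nd_nnsfun_approx.
transitivity (limn (fun n => \int[m]_x (h_ n x)%:E)).
  rewrite -monotone_convergence//.
  - by apply: eq_integral => x _; apply/esym/cvg_lim => //; exact: h_cvg.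
  - by move=> n; exact/measurable_EFinP.
  - by move=> n x _; rewrite lee_fin.
transitivity (limn (fun n => \int[mu]_x ((h_ n (phi x))%:E * (g x)%:E))); last first.
  rewrite -monotone_convergence//.
  - apply: eq_integral => x _; apply/cvg_lim => //.
    by apply: cvgeZr => //; exact: h_cvg.
  - move=> n; apply: emeasurable_funM => //; apply/measurable_EFinP.
    exact: measurableT_comp.
  - by move=> n x _; rewrite mule_ge0// lee_fin.
  - by move=> x _ a b ab; rewrite lee_wpmul2r ?lee_fin//; apply/lefP/nd_nnsfun_approx.
apply: congr_lim; apply/funext => n.
transitivity (\sum_(y \in range (h_ n)) y%:E * m (h_ n @^-1` [set y])).
  under eq_integral do rewrite fimfunE -fsumEFin//.
  rewrite ge0_integral_fsum//; last 2 first.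
  - by move=> r; exact/measurable_EFinP/measurable_funM.
  - by move=> r x _; rewrite nnfun_muleindic_ge0.
  apply: eq_fsbigr => r _.
  by rewrite integralZl_indic_nnsfun// integral_indic// setIT.
transitivity (\int[mu]_x \sum_(y \in range (h_ n))
    ((y * \1_(h_ n @^-1` [set y]) (phi x))%:E * (g x)%:E)); last first.
  apply: eq_integral => x _; rewrite -ge0_mule_fsuml; last first.
    by move=> r; exact: nnfun_muleindic_ge0.
  by rewrite fsumEFin// -(fimfunE _ (phi x)).
rewrite ge0_integral_fsum//; last 2 first.
- move=> r; apply: emeasurable_funM => //; apply/measurable_EFinP.
  by apply: measurable_funM => //; apply: measurableT_comp.
- by move=> r x _; rewrite mule_ge0 ?lee_fin//; exact: nnfun_muleindic_ge0.
apply: eq_fsbigr => r /[!inE] -[t _ rE].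
under eq_integral do rewrite EFinM -muleA.
rewrite ge0_integralZl//; last 3 first.
- apply: emeasurable_funM => //; apply/measurable_EFinP.
  exact: measurableT_comp.
- by move=> x _; rewrite mule_ge0 ?lee_fin.
- by rewrite lee_fin -rE.
rewrite mE// [in LHS]integral_mkcond.
congr (_ * _); apply: eq_integral => x _.
by rewrite epatch_indic muleC.
Qed.

Definition density_measure (A : set T) : \bar R := \int[mu]_(x in A) (g x)%:E.

Let density0 : density_measure set0 = 0.
Proof. by rewrite /density_measure integral_set0. Qed.

Let density_ge0 A : 0 <= density_measure A.
Proof. by apply: integral_ge0 => x _; rewrite lee_fin. Qed.

Let density_sigma_additive : semi_sigma_additive density_measure.
Proof.
move=> F mF tF mUF; rewrite /density_measure; apply: cvg_toP.
  apply: ereal_nondecreasing_is_cvgn => m n mn.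
  by apply: lee_sum_nneg_natr => // k _ _; apply: integral_ge0 => x _;
    rewrite lee_fin.
rewrite ge0_integral_bigcup//=.
- by apply/measurable_EFinP; exact: measurable_funTS.
- by move=> x _; rewrite lee_fin.
Qed.

HB.instance Definition _ := isMeasure.Build _ _ _ density_measure
  density0 density_ge0 density_sigma_additive.

Lemma exists_density_measure : exists m : {measure set T -> \bar R},
  forall A, m A = \int[mu]_(x in A) (g x)%:E.
Proof. by exists density_measure. Qed.

End density.

(** * Changes of variables on the half-line *)

Section substitution.
Context {R : realType}.
Local Notation mu := (@lebesgue_measure R).
Implicit Types (h : R -> \bar R) (x p c s : R).

(* Vanishing for x <= 0, so that integrals over the half-line or the unit
   interval become integrals over the whole line. *)
Definition ppow s x : R := if 0 < x then x `^ s else 0.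

Lemma ppow_ge0 s x : 0 <= ppow s x.
Proof. by rewrite /ppow; case: ifP => // _; exact: powR_ge0. Qed.

Lemma ppowE s x : 0 < x -> ppow s x = x `^ s.
Proof. by rewrite /ppow => ->. Qed.

Lemma ppow_le0 s x : x <= 0 -> ppow s x = 0.
Proof. by rewrite /ppow ltNge => ->. Qed.

Lemma measurable_ppow s : measurable_fun [set: R] (ppow s).
Proof.
apply: measurable_fun_ifT => //.
exact: measurable_fun_ltr.
Qed.

(** The image of Lebesgue measure under y -> p y + c, scaled by |p|, gives []a, b]] its length, so
    uniqueness of Lebesgue measure applies. For p < 0 the preimage is closed at the other end, which
    leaves its length unchanged. Negative slopes come from the substitutions with exponent -1 /
    alpha. *)
Lemma integral_affine p c h : p != 0 ->
  measurable_fun [set: R] h -> (forall x, 0 <= h x)%E ->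
  (`|p|%:E * \int[mu]_y h (p * y + c)%R = \int[mu]_x h x)%E.
Proof.
move=> p0 mh h0.
have mf : measurable_fun [set: R] (fun y : R => p * y + c).
  by apply: measurable_funD => //; exact: measurable_funM.
pose f : R -> measurableTypeR R := fun y => p * y + c.
have pge0 : 0 <= `|p| by [].
pose nu : {measure set (measurableTypeR R) -> \bar R} :=
  mscale (NngNum pge0)
  (measure_function_pushforward__canonical__measure_function_Measure mu
    (mf : measurable_fun setT f)).
have nuE A : measurable A -> mu A = nu A.
  apply: lebesgue_measure_unique => _ [[a b]] _ <-.
  rewrite /nu/= /mscale/= /pushforward.
  have [pp|pn] := ltP 0 p.
    have -> : f @^-1` `]a, b] = `](a - c) / p, (b - c) / p]%classic.
      apply/seteqP; split => x /=;
      by rewrite !in_itv/= ltr_pdivrMr// ler_pdivlMr// ltrBlDr lerBrDr mulrC.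
    rewrite !lebesgue_measure_itv/= !lte_fin ltr_pM2r ?invr_gt0// ltrD2r.
    case: ifP => _; last by rewrite mule0.
    rewrite gtr0_norm// -!EFinB -EFinM; congr EFin.
    by field; exact: lt0r_neq0.
  have {}pn : p < 0 by rewrite lt_neqAle p0.
  have -> : f @^-1` `]a, b] = `[(b - c) / p, (a - c) / p[%classic.
    apply/seteqP; split => x /=;
    by rewrite !in_itv/= ltr_ndivlMr// ler_ndivrMr// ltrBlDr lerBrDr mulrC andbC.
  rewrite !lebesgue_measure_itv/= !lte_fin ltr_nM2r ?invr_lt0// ltrD2r.
  case: ifP => _; last by rewrite mule0.
  rewrite ltr0_norm// -!EFinB -EFinM; congr EFin.
  by field.
rewrite [RHS](eq_measure_integral nu)//; last first.
  by move=> A mA _; exact: nuE.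
by rewrite ge0_integral_mscale//= ge0_integral_pushforward//.
Qed.

(* The image of Lebesgue measure under exp is the Haar measure dx / x. *)
Lemma integral_expR h :
  measurable_fun [set: R] h -> (forall x, 0 <= h x)%E ->
  (\int[mu]_y h (expR y) = \int[mu]_x (h x * (ppow (-1) x)%:E))%E.
Proof.
move=> mh h0.
have mp := measurable_ppow (-1).
pose lnR : R -> measurableTypeR R := @ln R.
have mln : measurable_fun [set: R] lnR by exact: measurable_ln.
have [m mE] := exists_density_measure mu mp (ppow_ge0 (-1)).
pose nu : {measure set (measurableTypeR R) -> \bar R} :=
  measure_function_pushforward__canonical__measure_function_Measure m
    (mln : measurable_fun setT lnR).
(* By uniqueness it is enough that the image of dx / x under [ln] gives []a, b]] the mass ln (exp b)
   - ln (exp a), an instance of the fundamental theorem of calculus. The density vanishes for x <=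
   0, where [ln] only has a default value. *)
have nuE A : measurable A -> mu A = nu A.
  apply: lebesgue_measure_unique => _ [[a b]] _ <-.
  rewrite /nu/= /pushforward/= mE.
  rewrite lebesgue_measure_itv/= lte_fin.
  have [ab|ba] := ltP a b; last first.
    rewrite set_itv_ge ?preimage_set0 ?integral_set0//.
    by rewrite -leNgt bnd_simp.
  have eab : expR a < expR b by rewrite ltr_expR.
  have cinv x : 0 < x -> {for x, continuous (fun x : R => x^-1)}.
    by move=> x0; apply: continuousV; [exact: lt0r_neq0|exact: cvg_id].
  have itv0 x : x \in `[expR a, expR b] -> 0 < x.
    by rewrite in_itv/= => /andP[ax _]; exact: lt_le_trans (expR_gt0 a) ax.
  have oitv0 x : x \in `]expR a, expR b[ -> 0 < x.
    by move=> xab; apply: itv0; exact: subset_itv_oo_cc xab.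
  have mV : measurable_fun `[expR a, expR b] (fun x : R => x^-1).
    apply: subspace_continuous_measurable_fun => //.
    apply: continuous_in_subspaceT => x /[!inE] /itv0; exact: cinv.
  transitivity (\int[mu]_(x in `[expR a, expR b]) (x^-1)%:E)%E; last first.
    rewrite -integral_itv_obnd_cbnd; last first.
      apply/measurable_EFinP; apply: measurable_funS mV => //.
      exact: subset_itv_oc_cc.
    rewrite integral_mkcond [RHS]integral_mkcond; apply: eq_integral => x _.
    have xl : (x \in lnR @^-1` `]a, b]%classic) = (a < ln x <= b).
      by apply/idP/idP; rewrite inE/= in_itv.
    rewrite /patch xl mem_setE/= in_itv/=; have [x0|x0] := ltP 0 x; last first.
      rewrite (ppow_le0 _ x0) ltNge (le_trans x0 (expR_ge0 _))/=.
      by case: ifP.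
    rewrite ppowE// (powR_inv1 (ltW x0)) -(ltr_expR a) -(ler_expR _ b).
    by rewrite lnK ?posrE.
  rewrite (@continuous_FTC2 _ (fun x => x^-1) (@ln R))//.
  - by rewrite !expRK.
  - by apply: continuous_in_subspaceT => x /[!inE] /itv0; exact: cinv.
  - split.
    + by move=> x /oitv0 x0; apply: ex_derive; exact: is_derive1_ln.
    + by apply: cvg_at_right_filter; apply: continuous_ln; exact: expR_gt0.
    + by apply: cvg_at_left_filter; apply: continuous_ln; exact: expR_gt0.
  - move=> x /oitv0 x0; rewrite derive1E; apply: derive_val.
    exact: is_derive1_ln.
transitivity (\int[nu]_y h (expR y))%E.
  by apply: eq_measure_integral => A mA _; exact: nuE.
rewrite ge0_integral_pushforward//; last first.
  by apply: measurableT_comp.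
rewrite (@ge0_integral_density _ _ _ mu (ppow (-1)) mp (ppow_ge0 (-1))
  _ _ m (fun x => x))//=.
- apply: eq_integral => x _; rewrite /=.
  have [x0|x0] := ltP 0 x; first by rewrite /lnR lnK.
  by rewrite ppow_le0// !mule0.
- by apply: measurableT_comp => //; exact: measurableT_comp.
Qed.
End substitution.

Section power_substitution.
Context {R : realType}.
Local Notation mu := (@lebesgue_measure R).
Implicit Types (g h : R -> R) (x p c s : R).

(** In the coordinate y = ln x the map x -> c x ^ p reads y -> p y + ln c, so the formula is
    [integral_expR] used in both directions around [integral_affine]. The substituted integrand [g]
    is described by equations, which leaves only an algebraic identity between powers to check at
    each use. *)
Lemma ge0_integral_power_substitution c p g h : 0 < c -> p != 0 ->
  measurable_fun [set: R] h -> (forall x, 0 <= h x) ->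
  (forall x, x <= 0 -> h x = 0) -> (forall x, x <= 0 -> g x = 0) ->
  (forall x, 0 < x -> g x = h (c * x `^ p) * (`|p| * c * x `^ (p - 1))) ->
  (\int[mu]_x (g x)%:E = \int[mu]_x (h x)%:E)%E.
Proof.
move=> c0 p0 mh h0 hneg gneg gE.
(* [k] is the density of h dx with respect to dx / x. *)
pose k x := (h x * x)%:E.
have mk : measurable_fun [set: R] k.
  by apply/measurable_EFinP; exact: measurable_funM.
have k0 x : (0 <= k x)%E.
  rewrite lee_fin; have [x0|x0] := leP x 0; first by rewrite hneg// mul0r.
  by rewrite mulr_ge0// ltW.
have hE x : (h x)%:E = (k x * (ppow (-1) x)%:E)%E.
  rewrite -EFinM; have [x0|x0] := leP x 0; first by rewrite hneg// !mul0r.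
  by rewrite ppowE// powR_inv1 ?ltW// mulfK// lt0r_neq0.
under [RHS]eq_integral do rewrite hE.
rewrite -integral_expR//
  -(@integral_affine _ p (ln c) (fun y => k (expR y)))//; last first.
  by apply: measurableT_comp.
have mkc : measurable_fun [set: R] (fun x => k (c * x `^ p)).
  by apply: measurableT_comp => //; apply: measurable_funM => //.
have -> : (fun y => k (expR (p * y + ln c)%R)) = (fun y => k (c * (expR y) `^ p)).
  apply/funext => y; congr k; rewrite expRD lnK// mulrC; congr (_ * _).
  by rewrite /powR gt_eqF ?expR_gt0// expRK.
rewrite (@integral_expR _ (fun x => k (c * x `^ p)))//.
rewrite -ge0_integralZl//; last first.
- by move=> x _; rewrite mule_ge0// lee_fin ppow_ge0.
- apply: emeasurable_funM => //; apply/measurable_EFinP.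
  exact: measurable_ppow.
apply: eq_integral => x _; rewrite -!EFinM.
have [x0|x0] := leP x 0; first by rewrite gneg// ppow_le0// !mulr0.
rewrite gE// ppowE//; congr EFin.
rewrite powRD ?(lt0r_neq0 x0) ?implybT//.
by ring.
Qed.

(** Supplies the elementary power integrals: for x > 0, the condition that x ^ p lies in ]0, 1]
    means x <= 1 when p > 0 and x >= 1 when p < 0, so both kinds reduce to the length of the unit
    interval. *)
Lemma integral_power_indic p (A : set R) : p != 0 -> measurable A ->
  (\int[mu]_x (`|p| * ppow (p - 1) x * \1_A (x `^ p))%:E
   = mu (A `&` `]0%R, +oo[))%E.
Proof.
move=> p0 mA.
have mA0 : measurable (A `&` `]0%R, +oo[) by exact: measurableI.
rewrite (@ge0_integral_power_substitution 1 p _ (\1_(A `&` `]0%R, +oo[)))//.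
- by rewrite integral_indic// setIT.
- by move=> x x0; rewrite indicE memNset//= in_itv/= andbT => -[_]; rewrite ltNge x0.
- by move=> x x0; rewrite ppow_le0// mulr0 mul0r.
- move=> x x0; rewrite mul1r mulr1 ppowE// mulrC; congr (_ * _).
  rewrite !indicE; congr (_%:R); congr nat_of_bool.
  apply/idP/idP; rewrite !inE//=; last by case.
  by move=> ?; split=> //; rewrite in_itv/= andbT powR_gt0.
Qed.

End power_substitution.

(** * The Gamma and Beta functions *)

Lemma measurable_ppow_comp (R : realType) d (T : measurableType d) (s : R) (h : T -> R) :
  measurable_fun [set: T] h -> measurable_fun [set: T] (fun z => ppow s (h z)).
Proof. by move=> mh; exact: measurableT_comp (measurable_ppow s) mh. Qed.

Lemma measurable_expR_comp (R : realType) d (T : measurableType d) (h : T -> R) :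
  measurable_fun [set: T] h -> measurable_fun [set: T] (fun z => expR (h z)).
Proof. by move=> mh; exact: measurableT_comp mh. Qed.

Lemma measurable_oppr_comp (R : realType) d (T : measurableType d) (h : T -> R) :
  measurable_fun [set: T] h -> measurable_fun [set: T] (fun z => - h z).
Proof. by move=> mh; exact: measurableT_comp mh. Qed.

Ltac measurability := rewrite /=;
  repeat first [exact: measurable_cst | exact: measurable_id
    | exact: measurable_fst | exact: measurable_snd
    | apply: measurable_ppow_comp | apply: measurable_expR_comp
    | apply: measurable_oppr_comp | apply: measurable_funD
    | apply: measurable_funM].

Section gamma_beta.
Context {R : realType}.
Local Notation mu := (@lebesgue_measure R).
Implicit Types (a b s x t : R).

Lemma ge0_integralZl_real (k : R) (h : R -> R) :
  measurable_fun [set: R] h -> (forall x, 0 <= h x) -> 0 <= k ->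
  (\int[mu]_x (k * h x)%:E = k%:E * \int[mu]_x (h x)%:E)%E.
Proof.
move=> mh h0 k0; under eq_integral do rewrite EFinM.
by rewrite ge0_integralZl//; [exact/measurable_EFinP|move=> x _; rewrite lee_fin].
Qed.

Lemma tonelli_lebesgue (F : R -> R -> R) :
  measurable_fun [set: R * R] (fun z => F z.1 z.2) ->
  (forall x y, 0 <= F x y) ->
  (\int[mu]_x \int[mu]_y (F x y)%:E = \int[mu]_y \int[mu]_x (F x y)%:E)%E.
Proof.
move=> mF F0; apply: (@fubini_tonelli _ _ _ _ _ mu mu (fun z => (F z.1 z.2)%:E)).
  exact/measurable_EFinP.
by move=> z; rewrite lee_fin.
Qed.

Lemma integral_itv0y (g h : R -> \bar R) :
  (forall x, 0 < x -> g x = h x) -> (forall x, x <= 0 -> h x = 0%E) ->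
  (\int[mu]_(x in `]0%R, +oo[) g x = \int[mu]_x h x)%E.
Proof.
move=> gh h0; rewrite integral_mkcond; apply: eq_integral => x _.
rewrite /patch mem_setE/= in_itv/= andbT; case: ltP => [/gh//|/h0->//].
Qed.

(** A zero integral would make [h] vanish almost everywhere, whereas the unit interval has measure
    1. *)
Lemma integral_gt0_itv01 (h : R -> R) :
  measurable_fun [set: R] h -> (forall x, 0 <= h x) ->
  (forall x, 0 < x < 1 -> 0 < h x) -> (0 < \int[mu]_x (h x)%:E)%E.
Proof.
move=> mh h0 hp; rewrite lt0e; apply/andP; split; last first.
  by apply: integral_ge0 => x _; rewrite lee_fin.
apply/eqP => ih0.
have mh' : measurable_fun [set: R] (EFin \o h) by exact/measurable_EFinP.
have /(ae_eq_integral_abs mu measurableT mh') : (\int[mu]_x `|(EFin \o h) x| = 0)%E.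
  by rewrite -[RHS]ih0; apply: eq_integral => x _; rewrite /= ger0_norm.
move=> [A [mA muA0 sA]].
have : (mu `]0%R, 1%R[%classic <= mu A)%E.
  apply: le_measure; rewrite ?inE// => x /=; rewrite in_itv/= => x01.
  apply: sA => /= /(_ I) [] hx; have := hp x x01.
  by rewrite hx ltxx.
by rewrite muA0 lebesgue_measure_itv/= lte_fin ltr01 oppr0 adde0 lee_fin ler10.
Qed.

(* Extended-real valued, so that Tonelli applies before finiteness is known. *)
Definition gammaE s := (\int[mu]_x (ppow (s - 1) x * expR (- x))%:E)%E.

Definition betaE a b :=
  (\int[mu]_x (ppow (a - 1) x * ppow (b - 1) (1 - x))%:E)%E.

Lemma gamma_integrand_ge0 s x : 0 <= ppow (s - 1) x * expR (- x).
Proof. by rewrite mulr_ge0 ?ppow_ge0 ?expR_ge0. Qed.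

Lemma beta_integrand_ge0 a b x : 0 <= ppow (a - 1) x * ppow (b - 1) (1 - x).
Proof. by rewrite mulr_ge0 ?ppow_ge0. Qed.

Lemma measurable_gamma_integrand s :
  measurable_fun [set: R] (fun x => ppow (s - 1) x * expR (- x)).
Proof. by measurability. Qed.

Lemma measurable_beta_integrand a b :
  measurable_fun [set: R] (fun x => ppow (a - 1) x * ppow (b - 1) (1 - x)).
Proof. by measurability. Qed.

Hint Resolve gamma_integrand_ge0 beta_integrand_ge0 : core.
Hint Resolve measurable_gamma_integrand measurable_beta_integrand : core.

Lemma gammaE_gt0 s : (0 < gammaE s)%E.
Proof.
apply: integral_gt0_itv01 => // x /andP[x0 x1].
by rewrite mulr_gt0 ?expR_gt0// ppowE// powR_gt0.
Qed.

Lemma betaE_gt0 a b : (0 < betaE a b)%E.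
Proof.
apply: integral_gt0_itv01 => // x /andP[x0 x1].
by rewrite mulr_gt0// ppowE ?powR_gt0// subr_gt0.
Qed.

Lemma gammaE_lty s : 0 < s -> (gammaE s < +oo)%E.
Proof.
move=> s0.
(* [N] exceeds s + 1, so that x ^ (s + 1) <= x ^ N <= N! exp x for x > 1. *)
pose N := (Num.truncn (s + 1)).+1.
have sN : s + 1 < N%:R by rewrite /N; exact: truncnS_gt.
(* The integrand is at most x ^ (s - 1) on ]0, 1] and N! x ^ (- 2) on ]1, +oo[. *)
pose A := `]0%R, 1%R]%classic : set R.
pose g1 x := s^-1 * (`|s| * ppow (s - 1) x * \1_A (x `^ s)).
pose g2 x := (N`!)%:R * (`|-1| * ppow (-1 - 1) x * \1_A (x `^ (-1))).
have mA : measurable A by exact: measurable_itv.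
have mI p : measurable_fun [set: R] (fun x : R => (\1_A (x `^ p) : R)).
  by apply: measurableT_comp => //; exact: measurable_indic.
have mg1' : measurable_fun [set: R] (fun x => `|s| * ppow (s - 1) x * \1_A (x `^ s)).
  by apply: measurable_funM => //; measurability.
have mg2' : measurable_fun [set: R]
    (fun x : R => `|-1| * ppow (-1 - 1) x * \1_A (x `^ (-1))).
  by apply: measurable_funM => //; measurability.
have mg1 : measurable_fun [set: R] g1 by exact: measurable_funM.
have mg2 : measurable_fun [set: R] g2 by exact: measurable_funM.
have mg12 : measurable_fun [set: R] (fun x => g1 x + g2 x).
  exact: measurable_funD.
have g10' x : 0 <= `|s| * ppow (s - 1) x * \1_A (x `^ s).
  by rewrite !mulr_ge0 ?ppow_ge0.
have g20' x : 0 <= `|-1| * ppow (-1 - 1) x * \1_A (x `^ (-1)).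
  by rewrite !mulr_ge0 ?ppow_ge0.
have muA : mu (A `&` `]0%R, +oo[) = 1%E.
  rewrite setIidl; last by move=> x/=; rewrite !in_itv/= andbT => /andP[].
  by rewrite lebesgue_measure_itv/= lte_fin ltr01 oppr0 adde0.
have i1 : (\int[mu]_x (g1 x)%:E = s^-1%:E)%E.
  rewrite /g1 ge0_integralZl_real ?invr_ge0 ?ltW//.
  by rewrite integral_power_indic ?gt_eqF// muA mule1.
have i2 : (\int[mu]_x (g2 x)%:E = (N`!)%:R%:E)%E.
  rewrite /g2 ge0_integralZl_real//.
  by rewrite integral_power_indic ?oppr_eq0 ?oner_eq0// muA mule1.
apply: (@le_lt_trans _ _ (\int[mu]_x (g1 x + g2 x)%:E)%E); last first.
  under eq_integral do rewrite EFinD.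
  rewrite ge0_integralD//; [by rewrite i1 i2 -EFinD ltry|..].
  - by move=> x _; rewrite lee_fin mulr_ge0// invr_ge0 ltW.
  - by apply/measurable_EFinP; exact: measurable_funM.
  - by move=> x _; rewrite lee_fin mulr_ge0.
  - by apply/measurable_EFinP; exact: measurable_funM.
apply: ge0_le_integral => //.
- by move=> x _; rewrite lee_fin.
- by apply/measurable_EFinP; exact: measurable_gamma_integrand.
- by apply/measurable_EFinP; exact: mg12.
move=> x _; rewrite lee_fin.
have [x0|x0] := leP x 0.
  by rewrite ppow_le0// mul0r addr_ge0// mulr_ge0// invr_ge0 ltW.
have [x1|x1] := leP x 1.
  rewrite -[leLHS]addr0 lerD//; last by rewrite mulr_ge0.
  rewrite /g1 indicE mem_set; last first.
    rewrite /A/= in_itv/= powR_gt0//= (_ : 1 = 1 `^ s); last by rewrite powR1.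
    by apply: ge0_ler_powR; rewrite ?nnegrE// ltW.
  rewrite mulr1 gtr0_norm// mulrA mulVf ?gt_eqF// mul1r.
  by rewrite ler_piMr ?ppow_ge0// -expR0 ler_expR oppr_le0 ltW.
rewrite -[leLHS]add0r lerD//; first by rewrite mulr_ge0// invr_ge0 ltW.
rewrite /g2 indicE mem_set; last first.
  by rewrite /A/= in_itv/= powR_gt0//= (powR_inv1 (ltW x0)) invf_le1// ltW.
rewrite mulr1 normrN1 mul1r !ppowE//.
rewrite expRN ler_pdivrMr ?expR_gt0//.
have : x ^+ N / N`!%:R <= expR x.
  apply: le_trans (expR_ge1Dxn N.-1 (ltW x0)).
  by rewrite lerDr.
rewrite ler_pdivrMr ?ltr0n ?fact_gt0// => xN.
rewrite (_ : s - 1 = (-1 - 1) + (s + 1)); last by ring.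
rewrite powRD ?(lt0r_neq0 x0) ?implybT// [leRHS]mulrAC [leRHS]mulrC.
rewrite ler_wpM2l ?powR_ge0// mulrC (le_trans _ xN)// -(powR_mulrn _ (ltW x0)).
by rewrite ler_powR ?ltW.
Qed.

Lemma gammaE_betaE a b : 0 < a -> 0 < b ->
  (gammaE a * gammaE b = betaE a b * gammaE (a + b))%E.
Proof.
move=> a0 b0.
(* Integrand of the product after the translation r = s + t of the second
   variable; the scaling s = r x then isolates the Beta integral. *)
pose F s r := ppow (a - 1) s * ppow (b - 1) (r - s) * expR (- r).
have F0 s r : 0 <= F s r by rewrite !mulr_ge0 ?ppow_ge0 ?expR_ge0.
have mF : measurable_fun [set: R * R] (fun z => F z.1 z.2).
  by rewrite /F; measurability.
transitivity (\int[mu]_s \int[mu]_r (F s r)%:E)%E.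
  rewrite /gammaE -ge0_integralZr//; last 3 first.
  - by apply/measurable_EFinP; exact: measurable_gamma_integrand.
  - by move=> x _; rewrite lee_fin.
  - by apply: integral_ge0 => x _; rewrite lee_fin.
  apply: eq_integral => s _; rewrite -ge0_integralZl_real//.
  rewrite -(@integral_affine _ 1 (- s)) ?oner_eq0//; last 2 first.
  - by apply/measurable_EFinP; measurability.
  - by move=> x; rewrite lee_fin mulr_ge0.
  rewrite normr1 mul1e; apply: eq_integral => r _; congr EFin.
  rewrite /F mul1r opprD opprK expRD expRN.
  by field; rewrite gt_eqF// expR_gt0.
rewrite tonelli_lebesgue// /gammaE -ge0_integralZl//; last 3 first.
- by apply/measurable_EFinP; exact: measurable_gamma_integrand.
- by move=> x _; rewrite lee_fin.
- by apply: integral_ge0 => x _; rewrite lee_fin.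
apply: eq_integral => r _.
have [r0|r0] := leP r 0.
  rewrite [in RHS]ppow_le0// mul0r mule0 integral0_eq// => s _; congr EFin.
  rewrite /F; have [s0|s0] := leP s 0; first by rewrite ppow_le0// !mul0r.
  by rewrite [X in _ * X * _]ppow_le0 ?mulr0 ?mul0r// subr_le0 (le_trans r0)// ltW.
rewrite -(@integral_affine _ r 0) ?gt_eqF//; last 2 first.
- by apply/measurable_EFinP; rewrite /F; measurability.
- by move=> x; rewrite lee_fin.
have pM s x : ppow s (r * x) = r `^ s * ppow s x.
  have [x0|x0] := leP x 0; first by rewrite !ppow_le0 ?mulr0// pmulr_rle0.
  by rewrite !ppowE ?mulr_gt0// powRM ?ltW.
under eq_integral => x _.
  rewrite (_ : F _ _ = (r `^ (a - 1) * r `^ (b - 1) * expR (- r)) *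
    (ppow (a - 1) x * ppow (b - 1) (1 - x))); last first.
    rewrite /F addr0 pM (_ : r - r * x = r * (1 - x)); last by ring.
    by rewrite pM; ring.
  over.
rewrite ge0_integralZl_real//; last by rewrite !mulr_ge0 ?powR_ge0 ?expR_ge0.
rewrite muleA muleC; congr (_ * _)%E.
rewrite -EFinM gtr0_norm// ppowE//; congr EFin.
rewrite (_ : a + b - 1 = (a - 1) + (b - 1) + 1); last by ring.
rewrite !powRD ?(lt0r_neq0 r0) ?implybT// (powRr1 (ltW r0)).
by ring.
Qed.

End gamma_beta.

Section gamma_real.
Context {R : realType}.
Local Notation mu := (@lebesgue_measure R).
Implicit Types (a b s x t : R).

(* Comparing two values of [Gamma] makes tactics unfold the integrals. *)
Definition gamma : R -> R := locked (@Gamma R).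

Lemma GammaE : @Gamma R = gamma.
Proof. exact: lock. Qed.

Lemma Gamma_gammaE s : Gamma s = fine (gammaE s).
Proof.
rewrite /Gamma /Rintegral /gammaE; congr fine; apply: integral_itv0y.
- by move=> x x0; rewrite ppowE.
- by move=> x x0; rewrite ppow_le0// mul0r.
Qed.

Lemma Beta_betaE a b : Beta a b = fine (betaE a b).
Proof.
rewrite /Beta /Rintegral /betaE; congr fine.
rewrite integral_mkcond; apply: eq_integral => x _.
rewrite /patch mem_setE/= in_itv/=; have [x0|x0] := leP x 0.
  by rewrite ppow_le0// mul0r.
have [x1|x1] := ltP x 1; first by rewrite !ppowE// subr_gt0.
by rewrite [ppow (b - 1) _]ppow_le0 ?mulr0// subr_le0.
Qed.

Lemma gammaE_fin_num s : 0 < s -> gammaE s \is a fin_num.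
Proof. by move=> s0; rewrite ge0_fin_numE ?gammaE_lty// ltW// gammaE_gt0. Qed.

Lemma gammaE_gamma s : 0 < s -> gammaE s = (gamma s)%:E.
Proof. by move=> s0; rewrite -GammaE Gamma_gammaE fineK// gammaE_fin_num. Qed.

Lemma gamma_gt0 s : 0 < s -> 0 < gamma s.
Proof. by move=> s0; rewrite -lte_fin -gammaE_gamma// gammaE_gt0. Qed.

(** Finiteness of the Beta integral comes out of the product formula: an infinite value would make
    the finite product of the two Gamma values infinite. *)
Lemma betaE_gamma a b : 0 < a -> 0 < b ->
  betaE a b = (gamma a * gamma b / gamma (a + b))%:E.
Proof.
move=> a0 b0; have ab0 : 0 < a + b by rewrite addr_gt0.
have := gammaE_betaE a0 b0; rewrite !gammaE_gamma// => abE.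
have := betaE_gt0 a b; move: abE; case: (betaE a b) => [r| |] //=.
- by rewrite -!EFinM => -[->] _; rewrite mulfK// gt_eqF// gamma_gt0.
- by rewrite mulyr gtr0_sg ?gamma_gt0// mul1e.
Qed.

Lemma Beta_gamma a b : 0 < a -> 0 < b ->
  Beta a b = gamma a * gamma b / gamma (a + b).
Proof. by move=> a0 b0; rewrite Beta_betaE betaE_gamma. Qed.

Lemma gamma1 : gamma (1 : R) = 1.
Proof.
apply/eqP; rewrite -eqe -gammaE_gamma//; apply/eqP.
rewrite -(integral_exponential_pdf (@ltr01 R)) /gammaE.
pose h x : \bar R := (1 * expR (- 1 * x))%:E.
transitivity (\int[mu]_(x in `]0%R, +oo[) h x)%E.
  apply/esym/integral_itv0y => x x0; last by rewrite ppow_le0// mul0r.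
  by rewrite /h ppowE// subrr powRr0 mulN1r.
rewrite integral_itv_obnd_cbnd; last first.
  apply: measurable_funTS; apply/measurable_EFinP.
  by apply: measurable_funM => //; apply: measurableT_comp => //; exact: measurable_funM.
rewrite integral_mkcond; apply: eq_integral => x _.
by rewrite /exponential_pdf/= /patch; case: ifP.
Qed.

(** Since x ^ a < 1 exactly when x < 1, the integrand is the derivative of x ^ a cut off by a
    condition on x ^ a itself, up to the factor 1 / a. *)
Lemma betaE1 a : 0 < a -> betaE a 1 = (a^-1)%:E.
Proof.
move=> a0; pose A := `]0%R, 1%R[%classic : set R.
have mA : measurable A by exact: measurable_itv.
have mI : measurable_fun [set: R] (fun x : R => (\1_A (x `^ a) : R)).
  by apply: measurableT_comp => //; exact: measurable_indic.
transitivity (\int[mu]_x (a^-1 * (`|a| * ppow (a - 1) x * \1_A (x `^ a)))%:E)%E.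
  apply: eq_integral => x _; congr EFin; rewrite subrr.
  have [x0|x0] := leP x 0; first by rewrite !(ppow_le0 _ x0) mulr0 !mul0r mulr0.
  rewrite gtr0_norm// !mulrA mulVf ?gt_eqF// mul1r; congr (_ * _).
  have xa : (x `^ a < 1) = (x < 1).
    have [x1|x1] := ltP x 1.
      have := @gt0_ltr_powR _ a a0 x 1; rewrite !nnegrE powR1; apply => //.
      exact: ltW.
    apply/negbTE; rewrite -leNgt.
    have := @ge0_ler_powR _ a (ltW a0) 1 x; rewrite !nnegrE powR1.
    by apply => //; exact: ltW.
  rewrite indicE mem_setE/= in_itv/= powR_gt0//= xa /ppow subr_gt0.
  by case: ifP => //; rewrite powRr0.
rewrite ge0_integralZl_real ?invr_ge0 ?(ltW a0)//; last 2 first.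
- by apply: measurable_funM => //; measurability.
- by move=> x; rewrite !mulr_ge0 ?ppow_ge0.
rewrite integral_power_indic ?gt_eqF// setIidl; last first.
  by move=> x/=; rewrite !in_itv/= andbT => /andP[].
by rewrite lebesgue_measure_itv/= lte_fin ltr01 oppr0 adde0 mule1.
Qed.

(** Compares two values of the Beta integral at (s, 1): Gamma s Gamma 1 / Gamma (s + 1) and 1 / s.
    This replaces an integration by parts. *)
Lemma gammaS s : 0 < s -> gamma (s + 1) = s * gamma s.
Proof.
move=> s0; have := betaE1 s0; rewrite betaE_gamma// gamma1 mulr1 => -[sE].
have s10 : 0 < s + 1 by rewrite addr_gt0.
have /(congr1 (fun y => y * (s * gamma (s + 1)))) := sE.
rewrite mulrCA mulfVK ?gt_eqF ?gamma_gt0// mulrA mulVf ?gt_eqF// mul1r.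
by move=> ->.
Qed.

Lemma integral_gamma_scale s x : 0 < s -> 0 < x ->
  (\int[mu]_l (ppow (s - 1) l * expR (- (l * x)))%:E
   = (gamma s * ppow (- s) x)%:E)%E.
Proof.
move=> s0 x0; rewrite EFinM -gammaE_gamma// muleC.
rewrite /gammaE -(@integral_affine _ x 0
  (fun t => (ppow (s - 1) t * expR (- t))%:E)) ?gt_eqF//; last 2 first.
- by apply/measurable_EFinP; exact: measurable_gamma_integrand.
- by move=> y; rewrite lee_fin; exact: gamma_integrand_ge0.
under [in RHS]eq_integral => y _.
  rewrite (_ : ppow (s - 1) _ * _ =
    x `^ (s - 1) * (ppow (s - 1) y * expR (- (y * x)))); last first.
    rewrite addr0 mulrA (mulrC x); congr (_ * _).
    have [y0|y0] := leP y 0; first by rewrite !ppow_le0 ?mulr0// pmulr_lle0.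
    by rewrite !ppowE ?mulr_gt0// powRM ?ltW// mulrC.
  over.
rewrite ge0_integralZl_real ?powR_ge0//; last 2 first.
- by measurability.
- by move=> y; rewrite mulr_ge0 ?ppow_ge0 ?expR_ge0.
rewrite !muleA -!EFinM ppowE// gtr0_norm// -[X in _ * X * _](powRr1 (ltW x0)).
rewrite -!powRD ?(lt0r_neq0 x0) ?implybT//.
by rewrite (_ : - s + 1 + (s - 1) = 0) ?powRr0 ?mul1e//; ring.
Qed.

Lemma integral_ppow_expR_power alpha s : 0 < alpha -> 0 < s ->
  (\int[mu]_l (ppow (s - 1) l * expR (- (l `^ alpha)))%:E
   = (gamma (s / alpha) / alpha)%:E)%E.
Proof.
move=> al0 s0; rewrite mulrC EFinM -gammaE_gamma ?divr_gt0// /gammaE.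
rewrite -ge0_integralZl_real ?invr_ge0 ?ltW//; last 2 first.
- exact: measurable_gamma_integrand.
- exact: gamma_integrand_ge0.
apply: (@ge0_integral_power_substitution _ 1 alpha) => //.
- by rewrite gt_eqF.
- by apply: measurable_funM => //; exact: measurable_gamma_integrand.
- by move=> x; rewrite mulr_ge0 ?gamma_integrand_ge0// invr_ge0 ltW.
- by move=> x x0; rewrite ppow_le0// mul0r mulr0.
- by move=> x x0; rewrite ppow_le0// mul0r.
move=> x x0; rewrite mul1r mulr1 !ppowE ?powR_gt0// -powRrM gtr0_norm//.
rewrite (_ : s - 1 = alpha * (s / alpha - 1) + (alpha - 1)); last first.
  by field; rewrite gt_eqF.
rewrite [x `^ (_ + (alpha - 1))]powRD ?(lt0r_neq0 x0) ?implybT//.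
by field; rewrite gt_eqF.
Qed.

End gamma_real.

(** * Moments *)

Section halfline.
Context {R : realType}.
Local Notation mu := (@lebesgue_measure R).
Implicit Types (a b s x t : R) (f : R -> R).

(** A stable density is only controlled on the half-line; its extension by zero is measurable and
    nonnegative on the whole line, as Tonelli and the substitution lemma require. *)
Definition halfline f x : R := if 0 < x then f x else 0.

Lemma halflineE f x : 0 < x -> halfline f x = f x.
Proof. by rewrite /halfline => ->. Qed.

Lemma halfline_le0 f x : x <= 0 -> halfline f x = 0.
Proof. by rewrite /halfline ltNge => ->. Qed.

Lemma halfline_ge0 f x : (forall x, 0 < x -> 0 <= f x) -> 0 <= halfline f x.
Proof. by rewrite /halfline => f0; case: ifP => // /f0. Qed.

Lemma measurable_halfline f :
  measurable_fun (`]0, +oo[ : set R) f -> measurable_fun [set: R] (halfline f).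
Proof.
move=> mf; rewrite (_ : halfline f = f \_ `]0, +oo[); last first.
  by apply/funext => x; rewrite /halfline /patch mem_setE/= in_itv/= andbT.
by apply/(measurable_restrictT _ _).1.
Qed.

Lemma integral_itv0y_halfline f : 
  (\int[mu]_(x in `]0%R, +oo[) (f x)%:E = \int[mu]_x (halfline f x)%:E)%E.
Proof.
apply: integral_itv0y => x x0; first by rewrite halflineE.
by rewrite halfline_le0.
Qed.

Lemma stable_density_neg_moment alpha f s :
  0 < alpha -> stable_density alpha f -> 0 < s ->
  (\int[mu]_x (ppow (- s) x * halfline f x)%:E
   = (gamma (s / alpha) / (alpha * gamma s))%:E)%E.
Proof.
move=> al0 [mf f0 laplace] s0.
have mf' := measurable_halfline mf.
have f0' x := halfline_ge0 x f0.
have Gs0 := gamma_gt0 s0.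
pose F l x := ppow (s - 1) l * expR (- (l * x)) * halfline f x.
have F0 l x : 0 <= F l x by rewrite !mulr_ge0 ?ppow_ge0 ?expR_ge0.
have mF : measurable_fun [set: R * R] (fun z => F z.1 z.2).
  apply: measurable_funM; first by measurability.
  by apply: measurableT_comp.
have := tonelli_lebesgue mF F0.
under eq_integral => l _.
  rewrite (_ : (\int[mu]_y _)%E =
    (ppow (s - 1) l * expR (- (l `^ alpha)))%:E); last first.
    have [l0|l0] := leP l 0.
      by rewrite integral0_eq => [|x _]; rewrite /F ppow_le0// !mul0r.
    rewrite EFinM -laplace ?ltW// integral_itv0y_halfline.
    rewrite -ge0_integralZl_real ?ppow_ge0//; last 2 first.
    - apply: measurable_halfline; apply: measurable_funM => //.
      by apply: measurable_funTS; apply: measurable_expR_comp; measurability.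
    - by move=> x; apply: halfline_ge0 => y y0; rewrite mulr_ge0 ?expR_ge0 ?f0.
    apply: eq_integral => x _; congr EFin; rewrite /F.
    have [x0|x0] := leP x 0; first by rewrite !halfline_le0// !mulr0.
    by rewrite !halflineE// mulrA.
  over.
rewrite integral_ppow_expR_power//.
under [in RHS]eq_integral => x _.
  rewrite (_ : (\int[mu]_y _)%E =
    (gamma s * (ppow (- s) x * halfline f x))%:E); last first.
    have [x0|x0] := leP x 0.
      by rewrite integral0_eq => [|l _]; rewrite /F halfline_le0// !mulr0.
    rewrite mulrA EFinM -integral_gamma_scale// muleC.
    rewrite -ge0_integralZl_real//; last 2 first.
    - by measurability.
    - by move=> l; rewrite mulr_ge0 ?ppow_ge0 ?expR_ge0.
    by apply: eq_integral => l _; rewrite /F mulrC.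
  over.
rewrite ge0_integralZl_real ?(ltW Gs0)//; last 2 first.
- by apply: measurable_funM => //; exact: measurable_ppow.
- by move=> x; rewrite mulr_ge0 ?ppow_ge0.
(* The division by Gamma s takes place in the extended reals, since the moment is not yet known to
   be finite. *)
move=> /(congr1 (fun y => (gamma s)^-1%:E * y))%E.
rewrite muleA -!EFinM mulVf ?gt_eqF// mul1e => <-; congr EFin.
by field; rewrite !gt_eqF.
Qed.

End halfline.

Section moments.
Context {R : realType}.
Local Notation mu := (@lebesgue_measure R).
Implicit Types (a b s x t : R) (f g h : R -> R).

(** The density is meaningful on [D] only, so it is cut off by zero outside [D] before the law of
    [X] is recognized as a measure with a density on the line. *)
Lemma has_density_on_integral d (T : measurableType d) (P : probability T R)
    (D : set R) (X : {RV P >-> R}) g h :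
  measurable D -> has_density_on D X g ->
  measurable_fun [set: R] h -> (forall x, 0 <= h x) ->
  (\int[P]_w (h (X w))%:E = \int[mu]_(x in D) (h x * g x)%:E)%E.
Proof.
move=> mD [mg g0 XE] mh h0.
have mg' : measurable_fun [set: R] (g \_ D) by apply/(measurable_restrictT _ _).1.
have g0' x : 0 <= (g \_ D) x.
  by rewrite /patch; case: ifPn => // /set_mem; exact: g0.
have mh' : measurable_fun [set: R] (EFin \o h) by exact/measurable_EFinP.
transitivity (\int[distribution P X]_y (EFin \o h) y)%E.
  by rewrite ge0_integral_distribution// => x; rewrite lee_fin.
have -> : (\int[distribution P X]_y (EFin \o h) y =
    \int[mu]_y ((EFin \o h) y * ((g \_ D) y)%:E))%E.
  apply: (@ge0_integral_density _ _ _ mu (g \_ D) mg' g0' _ _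
    (distribution P X) (fun x => x) (EFin \o h)) => //.
  move=> A mA; apply: etrans (XE A mA) _; rewrite integral_mkcondr.
  apply: eq_integral => x _.
  by rewrite /patch; case: ifP.
rewrite [RHS]integral_mkcond; apply: eq_integral => x _.
by rewrite -EFinM /patch; case: ifPn => //=; rewrite mulr0.
Qed.

(** The law gives the complement of [D] an integral over the empty set. This is the source of the
    almost sure signs that allow moments of |W| to stand for moments of W. *)
Lemma has_density_on_ae d (T : measurableType d) (P : probability T R)
    (D : set R) (X : {RV P >-> R}) g :
  measurable D -> has_density_on D X g -> {ae P, forall w, D (X w)}.
Proof.
move=> mD [_ _ XE]; exists (X @^-1` ~` D); split => //.
- by rewrite -[X in measurable X]setTI; apply: measurable_funP => //; exact: measurableC.
- have := XE (~` D) (measurableC mD).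
  by rewrite setICl integral_set0.
Qed.

(** Under x = z ^ (-1 / alpha) the power z ^ (r + eta / alpha) becomes x ^ (- (eta + r alpha)), and
    the Jacobian is already a factor of [ML_density]. What remains is a negative moment of the
    stable law. *)
Lemma gML_moment alpha eta f (r : nat) : 0 < alpha -> 0 < eta ->
  stable_density alpha f ->
  (\int[mu]_(z in `]0%R, +oo[) (`|z| ^+ r * gML_density alpha eta f z)%:E
   = (gamma eta / gamma (eta / alpha) *
     (gamma (eta / alpha + r%:R) / gamma (eta + r%:R * alpha)))%:E)%E.
Proof.
move=> al0 eta0 sf; have [mf f0 _] := sf.
have ea0 : 0 < eta / alpha by rewrite divr_gt0.
have s0 : 0 < eta + r%:R * alpha by rewrite ltr_pwDl// mulr_ge0 ?(ltW al0).
pose C := gamma (eta + 1) / gamma (eta / alpha + 1).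
(* The functional equation, applied at eta and at eta / alpha, exposes the factor alpha that cancels
   the one in the denominator of the stable moment. *)
have CE : C = alpha * gamma eta / gamma (eta / alpha).
  rewrite /C !gammaS//; field.
  by rewrite !gt_eqF// gamma_gt0.
have C0 : 0 < C by rewrite divr_gt0// gamma_gt0// addr_gt0.
rewrite integral_itv0y_halfline.
pose h x := C * (ppow (- (eta + r%:R * alpha)) x * halfline f x).
have mh : measurable_fun [set: R]
    (fun x => ppow (- (eta + r%:R * alpha)) x * halfline f x).
  apply: measurable_funM; first exact: measurable_ppow.
  exact: measurable_halfline.
have h0 x : 0 <= ppow (- (eta + r%:R * alpha)) x * halfline f x.
  by rewrite mulr_ge0 ?ppow_ge0// halfline_ge0.
have p0 : - alpha^-1 != 0 by rewrite oppr_eq0 invr_eq0 gt_eqF.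
rewrite (@ge0_integral_power_substitution _ 1 (- alpha^-1) _ h)//; last 5 first.
- exact: measurable_funM.
- by move=> x; rewrite mulr_ge0 ?h0 ?ltW.
- by move=> x x0; rewrite /h ppow_le0// mul0r mulr0.
- by move=> x x0; rewrite halfline_le0.
- move=> x x0; rewrite halflineE// mul1r mulr1 /gML_density /ML_density GammaE -/C.
  rewrite /h ppowE ?powR_gt0// halflineE ?powR_gt0// -powRrM.
  rewrite normrN [`|alpha^-1|]gtr0_norm ?invr_gt0// [`|x|]gtr0_norm//.
  rewrite -(powR_mulrn _ (ltW x0)).
  rewrite (_ : - alpha^-1 * - _ = r%:R + eta / alpha); last first.
    by field; rewrite gt_eqF.
  rewrite [x `^ (r%:R + _)]powRD ?(lt0r_neq0 x0) ?implybT//.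
  rewrite (_ : - alpha^-1 - 1 = - 1 - alpha^-1); last by ring.
  by ring.
rewrite /h ge0_integralZl_real ?(ltW C0)// (stable_density_neg_moment al0 sf s0).
rewrite -EFinM CE; congr EFin.
rewrite (_ : (eta + r%:R * alpha) / alpha = eta / alpha + r%:R); last first.
  by field; rewrite gt_eqF.
by field; rewrite !gt_eqF// gamma_gt0.
Qed.

Lemma Beta_moment a b (r : nat) : 0 < a -> 0 < b ->
  (\int[mu]_(x in `]0%R, 1%R[) (`|x| ^+ r * Beta_density a b x)%:E
   = (gamma (a + r%:R) * gamma (a + b) / (gamma a * gamma (a + b + r%:R)))%:E)%E.
Proof.
move=> a0 b0; have ab0 : 0 < a + b by rewrite addr_gt0.
have ar0 : 0 < a + r%:R by rewrite ltr_wpDr.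
have abr0 : 0 < a + b + r%:R by rewrite ltr_wpDr.
have B0 : 0 < Beta a b.
  by rewrite Beta_gamma// divr_gt0 ?mulr_gt0 ?gamma_gt0.
transitivity ((Beta a b)^-1%:E * betaE (a + r%:R) b)%E.
  rewrite /betaE -ge0_integralZl_real ?invr_ge0 ?ltW//; last 2 first.
  - exact: measurable_beta_integrand.
  - exact: beta_integrand_ge0.
  rewrite integral_mkcond; apply: eq_integral => x _.
  rewrite /patch mem_setE/= in_itv/=; have [x0|x0] := leP x 0.
    by rewrite ppow_le0// mul0r mulr0.
  have [x1|x1] := ltP x 1; last first.
    by rewrite [ppow (b - 1) _]ppow_le0 ?mulr0// subr_le0.
  rewrite !ppowE ?subr_gt0// /Beta_density gtr0_norm// -(powR_mulrn _ (ltW x0)).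
  rewrite (_ : a + r%:R - 1 = r%:R + (a - 1)); last by ring.
  rewrite [x `^ (r%:R + _)]powRD ?(lt0r_neq0 x0) ?implybT//.
  by congr EFin; field; rewrite gt_eqF.
rewrite betaE_gamma// Beta_gamma// -EFinM; congr EFin.
rewrite (_ : a + r%:R + b = a + b + r%:R); last by ring.
by field; rewrite !gt_eqF// gamma_gt0.
Qed.

End moments.

(** * Moments of the density of Z *)

Section Z_moments.
Context {R : realType}.
Local Notation mu := (@lebesgue_measure R).
Variables (alpha b : R) (f : R -> R).
Hypotheses (al0 : 0 < alpha) (b0 : 0 < b) (sf : stable_density alpha f).
Implicit Types (s x z v : R).

Let f0' x : 0 <= halfline f x.
Proof. by case: sf => _ f0 _; exact: halfline_ge0. Qed.

Let mf' : measurable_fun [set: R] (halfline f).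
Proof. by case: sf => mf _ _; exact: measurable_halfline. Qed.

(** The integrand of [Z_density] on the whole plane. The first [ppow] vanishes for 0 < v <= z and
    thereby encodes the domain v > z; (z / v) ^ (1 / alpha) is split into two powers to make joint
    measurability immediate. Values at z <= 0 are removed later by the weight [ppow (s - 1) z]. *)
Definition Z_kernel z v : R :=
  ppow (b - 1) (1 - ppow alpha^-1 z * ppow (- alpha^-1) v)
  * halfline f (ppow (- alpha^-1) v) * ppow (- alpha^-1 - 1) v.

Lemma Z_kernel_ge0 z v : 0 <= Z_kernel z v.
Proof. by rewrite !mulr_ge0 ?ppow_ge0. Qed.

Lemma measurable_Z_kernel : measurable_fun [set: R * R] (fun w => Z_kernel w.1 w.2).
Proof.
rewrite /Z_kernel; apply: measurable_funM; last by measurability.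
apply: measurable_funM; first by measurability.
by apply: measurableT_comp => //; measurability.
Qed.

Lemma measurable_Z_kernel_r z : measurable_fun [set: R] (Z_kernel z).
Proof.
rewrite /Z_kernel; apply: measurable_funM; last by measurability.
apply: measurable_funM; first by measurability.
by apply: measurableT_comp => //; measurability.
Qed.

Lemma integral_Z_kernelE z : 0 < z ->
  (\int[mu]_(v in `]z, +oo[)
      ((1 - (z / v) `^ (alpha^-1)) `^ (b - 1)
       * f (v `^ (- alpha^-1)) * v `^ (- alpha^-1 - 1))%:E
   = \int[mu]_v (Z_kernel z v)%:E)%E.
Proof.
move=> z0; rewrite integral_mkcond; apply: eq_integral => v _.
rewrite /patch mem_setE/= in_itv/= andbT /Z_kernel.
have [v0|v0] := leP v 0.
  by rewrite ltNge (le_trans v0 (ltW z0))/= [ppow (_ - 1) v]ppow_le0// mulr0.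
have zv : ppow alpha^-1 z * ppow (- alpha^-1) v = (z / v) `^ alpha^-1.
  rewrite !ppowE// powRM ?invr_ge0 ?(ltW z0) ?(ltW v0)//; congr (_ * _).
  by rewrite -(powR_inv1 (ltW v0)) -powRrM mulN1r.
rewrite zv [ppow (- alpha^-1) v]ppowE// halflineE ?powR_gt0//.
rewrite [ppow (_ - 1) v]ppowE//.
have ia0 : 0 < alpha^-1 by rewrite invr_gt0.
have zv0 : 0 < z / v by rewrite divr_gt0.
have [vz|zv'] := ltP z v.
  rewrite ppowE// subr_gt0.
  have := @gt0_ltr_powR _ _ ia0 (z / v) 1; rewrite !nnegrE powR1; apply => //.
    exact: ltW.
  by rewrite ltr_pdivrMr// mul1r.
rewrite ppow_le0 ?mul0r// subr_le0.
have := @ge0_ler_powR _ _ (ltW ia0) 1 (z / v); rewrite !nnegrE powR1; apply => //.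
  exact: ltW.
by rewrite ler_pdivlMr// mul1r.
Qed.

(** With z = v u ^ alpha at fixed v, one has z ^ (s - 1) dz = alpha v ^ s u ^ (alpha s - 1) du,
    which leaves a Beta integral with parameters alpha s and b. *)
Lemma integral_Z_kernel_dz s v : 0 < s -> 0 < v ->
  (\int[mu]_z (ppow (s - 1) z * Z_kernel z v)%:E
   = (alpha * Beta (alpha * s) b *
      (v `^ s * halfline f (v `^ (- alpha^-1)) * v `^ (- alpha^-1 - 1)))%:E)%E.
Proof.
move=> s0 v0; have as0 : 0 < alpha * s by rewrite mulr_gt0.
pose c := v `^ (- alpha^-1).
have c0 : 0 < c by rewrite powR_gt0.
pose A := alpha * (v `^ s * halfline f c * v `^ (- alpha^-1 - 1)).
have A0 : 0 <= A by rewrite !mulr_ge0 ?powR_ge0 ?(ltW al0).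
pose h u := A * (ppow (alpha * s - 1) u * ppow (b - 1) (1 - u)).
have ia0 : alpha^-1 != 0 by rewrite invr_eq0 gt_eqF.
have mh : measurable_fun [set: R] h.
  by apply: measurable_funM => //; exact: measurable_beta_integrand.
rewrite (@ge0_integral_power_substitution _ c alpha^-1 _ h)//; last 4 first.
- by move=> u; rewrite mulr_ge0// beta_integrand_ge0.
- by move=> u u0; rewrite /h ppow_le0// mul0r mulr0.
- by move=> z z0; rewrite ppow_le0// mul0r.
- move=> z z0; rewrite /h /Z_kernel [ppow (- alpha^-1) v]ppowE// -/c.
  rewrite [ppow (alpha * s - 1) _]ppowE ?mulr_gt0 ?powR_gt0//.
  rewrite [ppow alpha^-1 z]ppowE// [z `^ alpha^-1 * c]mulrC.
  rewrite [ppow (s - 1) z]ppowE// [ppow (_ - 1) v]ppowE//.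
  rewrite (@powRM _ c) ?powR_ge0 ?(ltW c0)// /A.
  rewrite gtr0_norm ?invr_gt0//.
  rewrite /c -!powRrM -/c.
  rewrite (_ : - alpha^-1 * (alpha * s - 1) = - s + alpha^-1); last first.
    by field; rewrite gt_eqF.
  rewrite (_ : s - 1 = alpha^-1 * (alpha * s - 1) + (alpha^-1 - 1)); last first.
    by field; rewrite gt_eqF.
  rewrite [z `^ (_ + (_ - 1))]powRD ?(lt0r_neq0 z0) ?implybT//.
  (* The power of v from c ^ (alpha s - 1) and the Jacobian factor c together undo the v ^ s
     contained in [A]. *)
  have cs : v `^ s * v `^ (- s + alpha^-1) * c = 1.
    rewrite /c -!powRD ?(lt0r_neq0 v0) ?implybT//.
    by rewrite (_ : _ + _ = 0) ?powRr0//; ring.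
  set X := ppow (b - 1) _; set Y := halfline f c; set W := v `^ (_ - 1).
  transitivity ((v `^ s * v `^ (- s + alpha^-1) * c) *
    (z `^ (alpha^-1 * (alpha * s - 1)) * z `^ (alpha^-1 - 1) * (X * Y * W))).
    by rewrite cs mul1r.
  by field; rewrite gt_eqF.
rewrite /h ge0_integralZl_real//; last 2 first.
- exact: measurable_beta_integrand.
- exact: beta_integrand_ge0.
rewrite -/(betaE _ _) betaE_gamma// -Beta_gamma// -EFinM; congr EFin.
by rewrite /A /c; ring.
Qed.

Definition Z_integral z := (\int[mu]_v (Z_kernel z v)%:E)%E.

Lemma Z_integral_ge0 z : (0 <= Z_integral z)%E.
Proof. by apply: integral_ge0 => v _; rewrite lee_fin Z_kernel_ge0. Qed.

Lemma measurable_Z_integral : measurable_fun [set: R] Z_integral.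
Proof.
apply: (@measurable_fun_fubini_tonelli_F _ _ _ _ _ mu (fun w => (Z_kernel w.1 w.2)%:E)).
  by apply/measurable_EFinP; exact: measurable_Z_kernel.
by move=> w; rewrite lee_fin Z_kernel_ge0.
Qed.

(** Once z is integrated out, x = v ^ (-1 / alpha) turns the integral over v into the negative
    moment of order alpha s of the stable law. Its denominator Gamma (alpha s) cancels against the
    Beta value. *)
Lemma moment_Z_integral s : 0 < s ->
  (\int[mu]_z ((ppow (s - 1) z)%:E * Z_integral z)
   = (alpha * gamma b * gamma s / gamma (alpha * s + b))%:E)%E.
Proof.
move=> s0; have as0 : 0 < alpha * s by rewrite mulr_gt0.
have asb0 : 0 < alpha * s + b by rewrite addr_gt0.
pose F z v := ppow (s - 1) z * Z_kernel z v.
have F0 z v : 0 <= F z v by rewrite mulr_ge0 ?ppow_ge0 ?Z_kernel_ge0.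
have mF : measurable_fun [set: R * R] (fun w => F w.1 w.2).
  by apply: measurable_funM; [measurability|exact: measurable_Z_kernel].
transitivity (\int[mu]_z \int[mu]_v (F z v)%:E)%E.
  apply: eq_integral => z _; rewrite -ge0_integralZl_real ?ppow_ge0//.
  - exact: measurable_Z_kernel_r.
  - by move=> v; exact: Z_kernel_ge0.
rewrite tonelli_lebesgue//.
pose C := alpha * Beta (alpha * s) b.
have C0 : 0 < C.
  by rewrite /C Beta_gamma// mulr_gt0// divr_gt0 ?mulr_gt0 ?gamma_gt0.
pose h x := C * alpha * (ppow (- (alpha * s)) x * halfline f x).
have mh' : measurable_fun [set: R] (fun x => ppow (- (alpha * s)) x * halfline f x).
  by apply: measurable_funM => //; exact: measurable_ppow.
have mh : measurable_fun [set: R] h by exact: measurable_funM.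
have h0' x : 0 <= ppow (- (alpha * s)) x * halfline f x.
  by rewrite mulr_ge0 ?ppow_ge0.
pose g v := C * (ppow s v * halfline f (ppow (- alpha^-1) v) * ppow (- alpha^-1 - 1) v).
transitivity (\int[mu]_v (g v)%:E)%E.
  apply: eq_integral => v _; rewrite /F; have [v0|v0] := leP v 0.
    rewrite /g [ppow s v]ppow_le0// !mul0r mulr0 integral0_eq// => z _.
    by rewrite /Z_kernel [ppow (_ - 1) v]ppow_le0// !mulr0.
  by rewrite integral_Z_kernel_dz// /g !ppowE.
have p0 : - alpha^-1 != 0 by rewrite oppr_eq0 invr_eq0 gt_eqF.
rewrite (@ge0_integral_power_substitution _ 1 (- alpha^-1) _ h)//; last 4 first.
- by move=> x; rewrite /h mulr_ge0 ?h0'// mulr_ge0 ?(ltW C0) ?(ltW al0).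
- by move=> x x0; rewrite /h ppow_le0// mul0r mulr0.
- by move=> v v0; rewrite /g ppow_le0// !mul0r mulr0.
- move=> v v0; rewrite /g /h !mul1r mulr1 !ppowE ?powR_gt0// -powRrM.
  rewrite normrN gtr0_norm ?invr_gt0//.
  rewrite (_ : - alpha^-1 * - (alpha * s) = s); last by field; rewrite gt_eqF.
  by field; rewrite gt_eqF.
have CA0 : 0 <= C * alpha by rewrite mulr_ge0 ?(ltW C0) ?(ltW al0).
rewrite /h ge0_integralZl_real//.
rewrite (stable_density_neg_moment al0 sf as0) -EFinM /C Beta_gamma//.
rewrite (_ : alpha * s / alpha = s); last by field; rewrite gt_eqF.
by congr EFin; field; rewrite !gt_eqF// gamma_gt0.
Qed.

End Z_moments.

Section Z_density_moment.
Context {R : realType}.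
Local Notation mu := (@lebesgue_measure R).

(** The factor z ^ r shifts the exponent s from a to a + r, and alpha a + b = theta + n for b = n -
    k alpha, so the Gamma value in the denominator becomes that at theta + n + r alpha. *)
Lemma Z_density_moment (alpha theta : R) (n k : nat) (f : R -> R) (r : nat) :
  0 < alpha -> 0 < theta / alpha + k%:R -> 0 < n%:R - k%:R * alpha ->
  stable_density alpha f ->
  measurable_fun (`]0, +oo[ : set R) (Z_density alpha theta n k f) ->
  (\int[mu]_(z in `]0%R, +oo[) (`|z| ^+ r * Z_density alpha theta n k f z)%:E
   = (gamma (theta / alpha + k%:R + r%:R) / gamma (theta / alpha + k%:R) *
     (gamma (theta + n%:R) / gamma (theta + n%:R + r%:R * alpha)))%:E)%E.
Proof.
move=> al0 a0 b0 sf mZ.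
set a := theta / alpha + k%:R in a0 *; set b := n%:R - k%:R * alpha in b0 *.
have etaE : theta + n%:R = alpha * a + b.
  by rewrite /a /b; field; rewrite gt_eqF.
have eta0 : 0 < theta + n%:R by rewrite etaE addr_gt0// mulr_gt0.
have ar0 : 0 < a + r%:R by rewrite ltr_pwDl.
pose I := Z_integral alpha b f.
have I0 z : (0 <= I z)%E by exact: Z_integral_ge0.
have mI : measurable_fun [set: R] I by exact: measurable_Z_integral.
pose C := gamma (theta + n%:R) / (gamma a * gamma b * alpha).
have C0 : 0 < C by rewrite divr_gt0 ?mulr_gt0 ?gamma_gt0.
have ZE z : 0 < z -> Z_density alpha theta n k f z = C * z `^ (a - 1) * fine (I z).
  move=> z0; rewrite /Z_density -/a -/b GammaE -/C; congr (_ * _).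
  by rewrite /Rintegral integral_Z_kernelE.
pose F s z := ((ppow (s - 1) z)%:E * I z)%E.
have mF s : measurable_fun [set: R] (F s).
  apply: emeasurable_funM => //; apply/measurable_EFinP.
  exact: measurable_ppow.
have F0 s z : (0 <= F s z)%E by rewrite mule_ge0// lee_fin ppow_ge0.
have FE s : 0 < s -> (\int[mu]_z F s z)%E =
    (alpha * gamma b * gamma s / gamma (alpha * s + b))%:E.
  exact: moment_Z_integral.
(* The unshifted integral is finite, and its weight z ^ (a - 1) is positive for z > 0; hence [I] is
   finite almost everywhere on the half-line. *)
have iF : mu.-integrable [set: R] (F a).
  apply/integrableP; split; first exact: mF.
  under eq_integral => z _ do rewrite gee0_abs//.
  by rewrite FE// ltry.
(* [Z_density] contains [fine (I z)], which is 0 where [I z] is infinite. *)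
have fin_ae : {ae mu, forall z, 0 < z -> I z \is a fin_num}.
  apply: filterS (integrable_ae measurableT iF) => z /(_ Logic.I) + z0.
  rewrite /F ppowE//; have := I0 z; case: (I z) => //= _.
  by rewrite mulry gtr0_sg ?powR_gt0// mul1e.
rewrite integral_itv0y_halfline.
transitivity (\int[mu]_z (C%:E * F (a + r%:R)%R z))%E.
  apply: ae_eq_integral => //.
  - apply/measurable_EFinP; apply: measurable_halfline.
    apply: measurable_funM => //; apply: measurable_funTS.
    apply: measurable_funX. exact: normr_measurable.
  - by apply: measurable_funeM; exact: mF.
  have [N [mN N0 sN]] := fin_ae; exists N; split => // z Nz; apply: sN => Iz.
  apply: Nz => _.
  rewrite /F; have [z0|z0] := leP z 0.
    by rewrite halfline_le0// ppow_le0// mul0e mule0.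
  rewrite halflineE// ppowE// -(fineK (Iz z0)) ZE// -!EFinM; congr EFin.
  rewrite gtr0_norm// -(powR_mulrn _ (ltW z0)).
  rewrite (_ : a + r%:R - 1 = r%:R + (a - 1)); last by ring.
  rewrite [z `^ (r%:R + _)]powRD ?(lt0r_neq0 z0) ?implybT//=.
  by ring.
rewrite ge0_integralZl//; last 2 first.
- exact: mF.
- by rewrite lee_fin ltW.
rewrite FE//.
rewrite -EFinM /C (_ : alpha * (a + r%:R) + b = theta + n%:R + r%:R * alpha); last first.
  by rewrite etaE; ring.
have ? : 0 < theta + n%:R + r%:R * alpha by rewrite ltr_pwDl ?mulr_ge0 ?(ltW al0).
by congr EFin; field; rewrite !gt_eqF// gamma_gt0.
Qed.

End Z_density_moment.

(** * From moments to characteristic functions *)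

Section growth.
Context {R : realType}.
Local Notation mu := (@lebesgue_measure R).
Implicit Types (a s x t K : R).

(** Integrates y ^ (1 - alpha) <= K ^ (- alpha) y + K ^ (1 - alpha) against y ^ (x + alpha - 1) exp
    (- y). The first summand alone is enough for y > K, the second for y <= K; [K] stays free so
    that it can grow with x. *)
Lemma gamma_increment_lower alpha K x : 0 < alpha -> alpha < 1 -> 0 < K -> 0 < x ->
  x * gamma x <=
  (K `^ (- alpha) * (x + alpha) + K `^ (1 - alpha)) * gamma (x + alpha).
Proof.
move=> al0 al1 K0 x0; have xa0 : 0 < x + alpha by rewrite addr_gt0.
rewrite -gammaS// mulrDl -mulrA -gammaS// -lee_fin EFinD !EFinM.
rewrite -!gammaE_gamma ?addr_gt0// /gammaE.
rewrite -!ge0_integralZl_real ?powR_ge0//; try by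
  [exact: measurable_gamma_integrand | exact: gamma_integrand_ge0].
have mk c s : measurable_fun [set: R]
    (fun y => c * (ppow (s - 1) y * expR (- y))).
  by apply: measurable_funM => //; exact: measurable_gamma_integrand.
have k0 c s y : 0 <= c -> 0 <= c * (ppow (s - 1) y * expR (- y)).
  by move=> c0; rewrite mulr_ge0// gamma_integrand_ge0.
rewrite -ge0_integralD//; last 4 first.
- by move=> y _; rewrite lee_fin k0// powR_ge0.
- by apply/measurable_EFinP; exact: mk.
- by move=> y _; rewrite lee_fin k0// powR_ge0.
- by apply/measurable_EFinP; exact: mk.
apply: ge0_le_integral => //.
- by move=> y _; rewrite lee_fin gamma_integrand_ge0.
- by apply/measurable_EFinP; exact: measurable_gamma_integrand.
- by apply: emeasurable_funD; apply/measurable_EFinP; exact: mk.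
move=> y _; rewrite -EFinD lee_fin.
have [y0|y0] := leP y 0; first by rewrite !ppow_le0// !mul0r !mulr0 addr0.
rewrite !mulrA -mulrDl ler_wpM2r ?expR_ge0// !ppowE//.
have pD u v : y `^ (u + v) = y `^ u * y `^ v.
  by rewrite powRD// (lt0r_neq0 y0) implybT.
rewrite (_ : x + 1 - 1 = (x + alpha - 1) + (1 - alpha)); last by ring.
rewrite (_ : x + alpha + 1 - 1 = (x + alpha - 1) + 1); last by ring.
rewrite !pD (powRr1 (ltW y0)); set Y := y `^ x * y `^ alpha * y `^ (-1).
have Y0 : 0 <= Y by rewrite !mulr_ge0 ?powR_ge0.
have yK : y `^ (1 - alpha) <= K `^ (- alpha) * y + K `^ (1 - alpha).
  have [yK|Ky] := leP y K.
    rewrite -[leLHS]add0r lerD ?mulr_ge0 ?powR_ge0 ?(ltW y0)//.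
    by apply: ge0_ler_powR; rewrite ?nnegrE ?subr_ge0 ?(ltW al1) ?(ltW y0) ?(ltW K0).
  rewrite -[leLHS]addr0 lerD ?powR_ge0// pD (powRr1 (ltW y0)) mulrC.
  rewrite ler_wpM2r ?(ltW y0)// !powRN lef_pV2 ?posrE ?powR_gt0//.
  by apply: ge0_ler_powR; rewrite ?nnegrE ?(ltW al0) ?(ltW y0) ?(ltW K0) ?(ltW Ky).
rewrite [leRHS](_ : _ = Y * (K `^ (- alpha) * y + K `^ (1 - alpha))); last by ring.
by rewrite ler_wpM2l//; move: yK; rewrite pD (powRr1 (ltW y0)).
Qed.

Lemma gamma_increment_ratio alpha e : 0 < alpha -> alpha < 1 -> 0 < e ->
  exists K, forall x, K <= x -> 0 < x /\ gamma x / gamma (x + alpha) <= e.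
Proof.
move=> al0 al1 e0.
(* For alpha < 1 <= K <= x one has x + alpha + K <= 3 x, so the bound on the quotient is 3 K ^ (-
   alpha); the first summand of [K] makes this at most e, and the second ensures K >= 1. *)
pose K := (3 / e) `^ alpha^-1 + 1.
have K1 : 1 <= K by rewrite lerDr powR_ge0.
have K0 : 0 < K by rewrite (lt_le_trans ltr01).
have Ke : 3 * K `^ (- alpha) <= e.
  rewrite powRN ler_pdivrMr ?powR_gt0// -ler_pdivrMl// mulrC.
  have <- : ((3 / e) `^ alpha^-1) `^ alpha = 3 / e.
    by rewrite -powRrM mulVf ?gt_eqF// powRr1// divr_ge0// ltW.
  by apply: ge0_ler_powR; rewrite ?nnegrE ?powR_ge0 ?(ltW al0) ?(ltW K0)// lerDl.
exists K => x Kx; have x0 := lt_le_trans K0 Kx; split => //.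
have xa0 : 0 < x + alpha by rewrite addr_gt0.
rewrite ler_pdivrMr ?gamma_gt0// -(ler_pM2l x0).
apply: le_trans (gamma_increment_lower al0 al1 K0 x0) _.
rewrite mulrA ler_wpM2r ?(ltW (gamma_gt0 xa0))//.
rewrite (@powRD _ K 1 (- alpha)) ?(lt0r_neq0 K0) ?implybT// (powRr1 (ltW K0)).
apply: (@le_trans _ _ (x * (3 * K `^ (- alpha)))); last by rewrite ler_wpM2l// ltW.
rewrite (mulrC K) -mulrDr mulrA mulrC ler_wpM2r ?powR_ge0//.
lra.
Qed.

Lemma cvg_series_ratio_half (u : R^nat) (N : nat) :
  (forall n, 0 <= u n) -> (forall n, (N <= n)%N -> u n.+1 <= u n / 2) ->
  cvgn (series u).
Proof.
move=> u0 uS.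
(* Each u n 2 ^ n with n <= N is a summand of [C], and beyond N the halving hypothesis preserves u n
   <= C / 2 ^ n, so a geometric series dominates. *)
pose C := \sum_(k < N.+1) u k * 2 ^+ k.
have uC n : u n <= C * 2^-1 ^+ n.
  have [nN|nN] := leqP n N.
    rewrite exprVn ler_pdivlMr ?exprn_gt0//.
    rewrite /C (bigD1 (inord n))//= inordK ?ltnS// lerDl sumr_ge0// => k _.
    by rewrite mulr_ge0// exprn_ge0.
  have {nN} := ltnW nN; elim: n => [|n IHn] nN.
    move: nN; rewrite leqn0 => /eqP N0; rewrite expr0 mulr1 /C N0.
    by rewrite big_ord_recl big_ord0/= expr0 mulr1 addr0.
  move: nN; rewrite leq_eqVlt => /orP[/eqP Nn|nN].
    rewrite exprVn ler_pdivlMr ?exprn_gt0//.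
    rewrite /C (bigD1 (inord n.+1))//= inordK ?Nn// lerDl sumr_ge0// => k _.
    by rewrite mulr_ge0// exprn_ge0.
  rewrite (le_trans (uS _ nN))// exprSr mulrA ler_wpM2r ?invr_ge0//.
  exact: IHn.
apply: (@series_le_cvg _ u (geometric C 2^-1)) => //.
- by move=> n; rewrite (le_trans (u0 n)).
- by apply: is_cvg_geometric_series; rewrite ger0_norm ?invr_ge0// invf_lt1// ltr1n.
Qed.

Lemma cvg_moment_series alpha a eta t : 0 < alpha -> alpha < 1 -> 0 < a -> 0 < eta ->
  cvgn (series (fun r => `|t| ^+ r / r`!%:R *
    (gamma (a + r%:R) / gamma a * (gamma eta / gamma (eta + r%:R * alpha))))).
Proof.
move=> al0 al1 a0 eta0.
(* As (a + r) / (r + 1) <= a + 1, this choice of [e] keeps the ratio of consecutive terms at most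
   1/2; the added 1 keeps the inverse meaningful at t = 0. *)
pose e := (2 * (`|t| * (a + 1) + 1))^-1.
have D0 : 0 < `|t| * (a + 1) + 1 by rewrite ltr_wpDl// mulr_ge0 ?addr_ge0 ?(ltW a0).
have e0 : 0 < e by rewrite invr_gt0 mulr_gt0.
have [K KE] := gamma_increment_ratio al0 al1 e0.
have ar0 r : 0 < a + r%:R by rewrite ltr_pwDl.
have er0 r : 0 < eta + r%:R * alpha by rewrite ltr_pwDl// mulr_ge0 ?(ltW al0).
apply: (@cvg_series_ratio_half _ (Num.truncn (`|K| / alpha)).+1).
  by move=> r; rewrite !mulr_ge0 ?exprn_ge0 ?invr_ge0 ?divr_ge0 ?(ltW (gamma_gt0 _)).
move=> r Nr.
have Kr : K <= eta + r%:R * alpha.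
  rewrite (le_trans (ler_norm K))// -[leLHS]add0r lerD ?(ltW eta0)//.
  rewrite -ler_pdivrMr// ltW// (lt_le_trans (truncnS_gt _))// ler_nat//.
have [_ le_e] := KE _ Kr.
rewrite (_ : eta + r.+1%:R * alpha = eta + r%:R * alpha + alpha); last first.
  by rewrite -natr1; ring.
rewrite (_ : a + r.+1%:R = a + r%:R + 1); last by rewrite -natr1 addrA.
rewrite gammaS// factS natrM exprS.
set G := gamma (eta + r%:R * alpha) in le_e *.
set G' := gamma (eta + r%:R * alpha + alpha) in le_e *.
have G0 : 0 < G by exact: gamma_gt0.
have G'0 : 0 < G' by apply: gamma_gt0; rewrite addr_gt0.
have Ga0 := gamma_gt0 a0.
pose U := `|t| ^+ r / r`!%:R * (gamma (a + r%:R) / gamma a * (gamma eta / G)).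
have U0 : 0 <= U.
  by rewrite !mulr_ge0 ?exprn_ge0 ?invr_ge0 ?divr_ge0 ?(ltW (gamma_gt0 _)).
rewrite -/U [leLHS](_ : _ = U * (`|t| * ((a + r%:R) / r.+1%:R) * (G / G'))); last first.
  by rewrite /U; field; rewrite !gt_eqF ?ltr0n ?fact_gt0.
rewrite ler_wpM2l//.
apply: (@le_trans _ _ (`|t| * (a + 1) * e)); last first.
  rewrite /e invfM mulrCA ler_piMr ?invr_ge0// ler_pdivrMr// mul1r.
  by rewrite lerDl.
apply: ler_pM => //.
- by rewrite mulr_ge0// divr_ge0// ltW.
- by rewrite divr_ge0// ltW.
rewrite ler_wpM2l// ler_pdivrMr ?ltr0n// -natr1.
have : 0 <= a * r%:R by rewrite mulr_ge0// ltW.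
have : (0 : R) <= r%:R by [].
by nra.
Qed.

End growth.

Section power_series_expectation.
Context d (T : measurableType d) (R : realType) (P : probability T R).

Lemma exp_term_le_expR (x : R) (r : nat) : 0 <= x -> x ^+ r / r`!%:R <= expR x.
Proof.
move=> x0; case: r => [|r].
  by rewrite expr0 fact0 divr1 -expR0 ler_expR.
by apply: le_trans (expR_ge1Dxn r x0); rewrite lerDr.
Qed.

Lemma nneseries_EFin (u : R^nat) : cvgn (series u) ->
  (\sum_(0 <= k <oo) (u k)%:E = (limn (series u))%:E)%E.
Proof.
move=> cu; rewrite -EFin_lim//; apply: congr_lim; apply/funext => n.
by rewrite /= /series/= sumEFin.
Qed.

(** Dominated convergence, stated for coefficients bounded by 1 so as to cover the cosine and sine
    series at once: every partial sum is at most exp (|t| |W|) in absolute value. *)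
Lemma cvg_power_series_expectation (W : T -> R) (M : nat -> R) (t : R)
    (c : R^nat) (F : R -> R) :
  measurable_fun [set: T] W -> measurable_fun [set: R] F ->
  {ae P, forall w, 0 <= W w} ->
  (forall r, (\int[P]_w (`|W w| ^+ r)%:E = (M r)%:E)%E) ->
  cvgn (series (fun r => `|t| ^+ r / r`!%:R * M r)) ->
  (forall r, `|c r| <= 1) ->
  (forall x, series (fun r => c r * (x ^+ r / r`!%:R)) @ \oo --> F x) ->
  series (fun r => c r * (t ^+ r / r`!%:R) * M r) @ \oo -->
    fine 'E_P[fun w => F (t * W w)].
Proof.
move=> mW mF W0 WM cM c1 cF.
have mnW r : measurable_fun [set: T] (fun w => `|W w| ^+ r).
  by apply: measurable_funX; exact: measurableT_comp.
have coef_ge0 r (x : R) : 0 <= `|x| ^+ r / r`!%:R by rewrite divr_ge0 ?exprn_ge0.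
have expE (y : R) : 0 <= y -> ((expR y)%:E = \sum_(0 <= k <oo) (y ^+ k / k`!%:R)%:E)%E.
  by move=> y0; apply/esym/nneseries_EFin; exact: is_cvg_series_exp_coeff.
pose g w := (expR (`|t| * `|W w|))%:E.
have mg : measurable_fun [set: T] g.
  apply/measurable_EFinP; apply: measurableT_comp => //.
  by apply: measurable_funM => //; exact: measurableT_comp.
(* All terms of the exponential series are nonnegative, so its expectation can be computed termwise
   and equals the sum of the convergent moment series. *)
have ig : P.-integrable [set: T] g.
  apply/integrableP; split => //.
  rewrite (eq_integral (fun w => \sum_(0 <= k <oo)
      (`|t| ^+ k / k`!%:R * `|W w| ^+ k)%:E)%E); last first.
    move=> w _; rewrite /g gee0_abs ?lee_fin ?expR_ge0// expE ?mulr_ge0//.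
    by apply: eq_eseriesr => k _; rewrite exprMn mulrAC.
  have mk k : measurable_fun [set: T]
      (fun w => (`|t| ^+ k / k`!%:R * `|W w| ^+ k)%:E).
    by apply/measurable_EFinP; exact: measurable_funM.
  have k0 k w : [set: T] w -> (0 <= (`|t| ^+ k / k`!%:R * `|W w| ^+ k)%:E)%E.
    by move=> _; rewrite lee_fin mulr_ge0 ?exprn_ge0.
  rewrite (integral_nneseries P measurableT mk k0).
  rewrite (eq_eseriesr (g := fun k => (`|t| ^+ k / k`!%:R * M k)%:E)); last first.
    move=> k _; under eq_integral do rewrite EFinM.
    rewrite ge0_integralZl ?WM//.
    - by apply/measurable_EFinP.
  by rewrite nneseries_EFin// ltry.
pose f_ n w := (series (fun r => c r * ((t * W w) ^+ r / r`!%:R)) n)%:E.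
have mterm r : measurable_fun [set: T] (fun w => c r * ((t * W w) ^+ r / r`!%:R)).
  apply: measurable_funM => //; apply: measurable_funM => //.
  by apply: measurable_funX; exact: measurable_funM.
have mf_ n : measurable_fun [set: T] (f_ n).
  apply/measurable_EFinP; rewrite /series/=.
  by apply: measurable_sum => r; exact: mterm.
have term_le r w : `|c r * ((t * W w) ^+ r / r`!%:R)| <=
    (`|t| * `|W w|) ^+ r / r`!%:R.
  rewrite normrM -[leRHS]mul1r ler_pM// normrM normrX normrM.
  by rewrite [X in _ * X <= _]ger0_norm// invr_ge0.
have f_g n w : (`|f_ n w| <= g w)%E.
  rewrite /f_ /g abse_EFin lee_fin.
  apply: (@le_trans _ _ (series (exp_coeff (`|t| * `|W w|)) n)).
    rewrite /series/=; apply: le_trans (ler_norm_sum _ _ _) _.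
    by apply: ler_sum => r _; exact: term_le.
  rewrite /expR; apply: nondecreasing_cvgn_le; last exact: is_cvg_series_exp_coeff.
  apply: nondecreasing_series => r _ _.
  by rewrite exp_coeff_ge0// mulr_ge0.
have mFW : measurable_fun [set: T] (fun w => (F (t * W w))%:E).
  apply/measurable_EFinP; apply: measurableT_comp => //.
  exact: measurable_funM.
have cvg_f w : f_ ^~ w @ \oo --> (F (t * W w))%:E.
  by apply: cvg_EFin; [exact: nearW|exact: cF].
have [iF _ cvgI] := @dominated_convergence _ _ _ P setT measurableT f_
  (fun w => (F (t * W w))%:E) g mf_ mFW
  (aeW _ (fun w _ => cvg_f w)) ig
  (aeW _ (fun w n _ => f_g n w)).
have iterm r : P.-integrable [set: T] (fun w => (c r * ((t * W w) ^+ r / r`!%:R))%:E).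
  apply: (le_integrable measurableT _ _ ig); first exact/measurable_EFinP.
  move=> w _; rewrite abse_EFin /g gee0_abs ?lee_fin ?expR_ge0//.
  apply: le_trans (term_le r w) _.
  by apply: exp_term_le_expR; rewrite mulr_ge0.
have imW r : P.-integrable [set: T] (fun w => (`|W w| ^+ r)%:E).
  apply/integrableP; split; first exact/measurable_EFinP.
  rewrite (eq_integral (fun w => (`|W w| ^+ r)%:E)) ?WM ?ltry// => w _.
  by rewrite gee0_abs// lee_fin exprn_ge0.
have If_ n : (\int[P]_w f_ n w)%E =
    (series (fun r => c r * (t ^+ r / r`!%:R) * M r) n)%:E.
  rewrite /f_ /series/=.
  under eq_integral do rewrite -sumEFin.
  rewrite integral_sum// -sumEFin; apply: eq_bigr => r _.
  (* The moments concern |W|, which agrees with W only almost surely. *)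
  transitivity (\int[P]_w ((c r * (t ^+ r / r`!%:R))%:E * (`|W w| ^+ r)%:E))%E.
    apply: ae_eq_integral => //.
    - exact/measurable_EFinP.
    - by apply: measurable_funeM; exact/measurable_EFinP.
    have [N [mN N0 sN]] := W0; exists N; split => // w Nw; apply: sN => Ww.
    apply: Nw => _; rewrite -EFinM ger0_norm// exprMn; congr EFin; ring.
  by rewrite integralZl// WM.
have -> : ('E_P[fun w => F (t * W w)%R] = \int[P]_w (F (t * W w)%R)%:E)%E.
  by rewrite unlock.
have fin : (\int[P]_w (F (t * W w))%:E)%E \is a fin_num by exact: integrable_fin_num.
move: cvgI; rewrite -(fineK fin) => /fine_cvg.
by apply: cvg_trans; apply: near_eq_cvg; apply: nearW => n; rewrite /= If_.
Qed.

End power_series_expectation.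

(** * Expectations of products of independent variables *)

Section independence.
Context d (T : measurableType d) (R : realType) (P : probability T R).
Local Open Scope ereal_scope.

(** Independence says that the joint law and the product of the laws agree on rectangles; uniqueness
    of the product measure identifies them, and Tonelli separates the factors. *)
Lemma independent_RV_integralM (X Y : {RV P >-> R}) (h1 h2 : R -> R) :
  independent_RV X Y ->
  measurable_fun [set: R] h1 -> measurable_fun [set: R] h2 ->
  (forall x, 0 <= h1 x)%R -> (forall x, 0 <= h2 x)%R ->
  \int[P]_w (h1 (X w) * h2 (Y w))%:E =
  \int[P]_w (h1 (X w))%:E * \int[P]_w (h2 (Y w))%:E.
Proof.
move=> XY mh1 mh2 h10 h20.
pose V w := (X w, Y w).
have mV : measurable_fun [set: T] V by exact: measurable_fun_pair.
pose m : {measure set (R * R) -> \bar R} :=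
  measure_function_pushforward__canonical__measure_function_Measure P mV.
pose h (z : R * R) := (h1 z.1 * h2 z.2)%:E.
have mh : measurable_fun [set: R * R] h.
  by apply/measurable_EFinP; apply: measurable_funM; exact: measurableT_comp.
have h0 z : 0 <= h z by rewrite lee_fin mulr_ge0.
have mE (h' : R -> R) : measurable_fun [set: R] h' ->
    measurable_fun [set: R] (EFin \o h').
  by move=> ?; exact/measurable_EFinP.
transitivity (\int[m]_z h z).
  by rewrite ge0_integral_pushforward.
transitivity (\int[distribution P X \x distribution P Y]_z h z).
  apply: eq_measure_integral => A mA _; apply/esym.
  by apply: product_measure_unique => // B C mB mC; exact: XY.
rewrite fubini_tonelli1//= /fubini_F /h/=.
have dE (Z : {RV P >-> R}) (h' : R -> R) : measurable_fun [set: R] h' ->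
    (forall x, 0 <= h' x)%R ->
    \int[distribution P Z]_y (h' y)%:E = \int[P]_w (h' (Z w))%:E.
  move=> mh' h'0; apply: (ge0_integral_distribution Z (mE _ mh')) => y.
  by rewrite lee_fin.
transitivity (\int[distribution P X]_x ((h1 x)%:E * \int[P]_w (h2 (Y w))%:E)).
  apply: eq_integral => x _; under eq_integral do rewrite EFinM.
  rewrite ge0_integralZl ?lee_fin ?dE//; first exact: mE.
  by move=> y _; rewrite lee_fin.
rewrite ge0_integralZr ?dE//; first exact: mE.
- by move=> y _; rewrite lee_fin.
- by apply: integral_ge0 => w _; rewrite lee_fin.
Qed.

End independence.

(** * Real and imaginary parts of complex series *)

Section complex_series.
Context {R : realType}.
Local Open Scope complex_scope.

Lemma cvg_complex (u v : R^nat) (a b : R) :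
  u @ \oo --> a -> v @ \oo --> b ->
  (fun n => (u n +i* v n : R[i]^o)) @ \oo --> (a +i* b : R[i]^o).
Proof.
move=> /cvgrPdist_le ua /cvgrPdist_le vb; apply/cvgrPdist_le => /= e.
rewrite ltcE/= => /andP[/eqP Ime0 Ree0].
(* A positive element of [R[i]] is real, so the tolerance is [Re e]; half of it for each part is
   enough, as the modulus is then at most Re e / sqrt 2. *)
have e20 : 0 < complex.Re e / 2 by rewrite divr_gt0.
near=> n.
have un : `|a - u n| <= complex.Re e / 2 by near: n; exact: ua.
have vn : `|b - v n| <= complex.Re e / 2 by near: n; exact: vb.
rewrite normc_def lecE/= Ime0 eqxx/= -[leRHS]ger0_norm ?(ltW Ree0)//.
rewrite -sqrtr_sqr ler_wsqrtr//.
rewrite -(ger0_norm (sqr_ge0 (a - _))) -(ger0_norm (sqr_ge0 (b - _))) !normrX.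
apply: (@le_trans _ _ ((complex.Re e / 2) ^+ 2 + (complex.Re e / 2) ^+ 2)).
  by rewrite lerD// lerXn2r ?nnegrE// ltW.
by nra.
Unshelve. all: by end_near. Qed.

(** The two parts are spelled as the coefficients in [cos_coeff] and [sin_coeff], which lets the
    series of real and imaginary parts match the library series for cosine and sine. *)
Lemma exp_complexi (r : nat) : ('i : R[i]) ^+ r =
  ((~~ odd r)%:R * (-1) ^ r./2) +i* ((odd r)%:R * (-1) ^+ r.-1./2).
Proof.
have i2 m : ('i : R[i]) ^+ m.*2 = ((-1) ^+ m)%:C.
  by rewrite -muln2 mulnC exprM sqr_i rmorphXn rmorphN1.
rewrite -[r in LHS]odd_double_half exprD i2.
case: (boolP (odd r)) => /= [r_odd|r_even].
  have -> : r.-1./2 = r./2.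
    by rewrite -[in LHS](odd_double_half r) r_odd/= doubleK.
  rewrite expr1 mul0r mul1r; apply/eqP; rewrite eq_complex/=.
  by apply/andP; split; apply/eqP; ring.
by rewrite expr0 mul1r mul0r mul1r.
Qed.

Lemma G_termE (alpha theta : R) (n k : nat) (t : R) (r : nat) :
  G_term alpha theta n k t r =
  let p := t ^+ r / r`!%:R *
    (poch ((theta + k%:R * alpha) / alpha) r%:R / poch (theta + n%:R) (r%:R * alpha)) in
  ((~~ odd r)%:R * (-1) ^ r./2 * p) +i* ((odd r)%:R * (-1) ^+ r.-1./2 * p).
Proof.
set p := (X in let p := X in _).
have -> : G_term alpha theta n k t r = 'i ^+ r * p%:C.
  rewrite /G_term exprMn -!mulrA; congr (_ * _).
  by rewrite /p !rmorphM !fmorphV/= rmorphXn rmorph_nat !mulrA.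
rewrite exp_complexi; apply/eqP; rewrite eq_complex/=.
by apply/andP; split; apply/eqP; ring.
Qed.

Lemma series_complex (u v : R^nat) (n : nat) :
  series (fun r => (u r +i* v r : R[i]^o)) n = (series u n +i* series v n : R[i]^o).
Proof.
elim: n => [|n IHn]; first by rewrite /series/= !big_geq.
by rewrite !seriesSr IHn.
Qed.

End complex_series.

(** Z and H enter only through their common moment sequence and their almost sure nonnegativity, so
    this one statement serves both. *)
Lemma char_fun_moments (R : realType) (alpha theta : R) (n k : nat)
    d (T : measurableType d) (P : probability T R) (W : T -> R) (t : R) :
  0 < alpha -> alpha < 1 -> 0 < (theta + k%:R * alpha) / alpha ->
  0 < theta + n%:R -> measurable_fun [set: T] W ->
  {ae P, forall w, 0 <= W w} ->
  (forall r, \int[P]_w (`|W w| ^+ r)%:E =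
    (poch ((theta + k%:R * alpha) / alpha) r%:R /
     poch (theta + n%:R) (r%:R * alpha))%:E)%E ->
  series (G_term alpha theta n k t) @ \oo --> (char_fun P W t : R[i]^o).
Proof.
move=> al0 al1 a0 eta0 mW W0 WM.
have cM := @cvg_moment_series _ _ _ _ t al0 al1 a0 eta0.
pose M r := poch ((theta + k%:R * alpha) / alpha) r%:R /
  poch (theta + n%:R) (r%:R * alpha).
have {}cM : cvgn (series (fun r => `|t| ^+ r / r`!%:R * M r)).
  rewrite (_ : (fun r => _) = (fun r => `|t| ^+ r / r`!%:R *
    (gamma ((theta + k%:R * alpha) / alpha + r%:R) /
     gamma ((theta + k%:R * alpha) / alpha) *
     (gamma (theta + n%:R) / gamma (theta + n%:R + r%:R * alpha)))))//.
  by apply/funext => r; rewrite /M /poch GammaE invf_div.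
pose u r := (~~ odd r)%:R * (-1) ^ r./2 * (t ^+ r / r`!%:R) * M r.
pose v r := (odd r)%:R * (-1) ^+ r.-1./2 * (t ^+ r / r`!%:R) * M r.
have GE : G_term alpha theta n k t = fun r => (u r +i* v r : R[i]^o)%C.
  by apply/funext => r; rewrite G_termE /u /v /M; congr (_ +i* _)%C; exact: mulrA.
have -> : series (G_term alpha theta n k t) =
    fun m => (series u m +i* series v m : R[i]^o)%C.
  by rewrite GE; apply/funext => m; exact: series_complex.
apply: cvg_complex.
- apply: (@cvg_power_series_expectation _ _ _ P W M t _ cos) => //.
  + apply: continuous_measurable_fun; exact: continuous_cos.
  + move=> r; rewrite normrM normr_nat -exprnP normrX normrN1 expr1n mulr1.
    by case: odd.
  + move=> x; rewrite (_ : series _ = series (cos_coeff x)); last first.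
      by congr series; apply/funext => r; rewrite /cos_coeff/= !mulrA.
    by rewrite unlock; exact: is_cvg_series_cos_coeff.
- apply: (@cvg_power_series_expectation _ _ _ P W M t _ sin) => //.
  + apply: continuous_measurable_fun; exact: continuous_sin.
  + move=> r; rewrite normrM normr_nat normrX normrN1 expr1n mulr1.
    by case: odd.
  + move=> x; rewrite (_ : series _ = series (sin_coeff x)); last first.
      by congr series; apply/funext => r; rewrite /sin_coeff/= !mulrA.
    by rewrite unlock; exact: is_cvg_series_sin_coeff.
Qed.

Theorem proposition8 (R : realType) (alpha theta : R) (n k : nat)
  (f : R -> R)
  (d : measure_display) (T : measurableType d) (P : probability T R)
  (Y1 X : {RV P >-> R})
  (d' : measure_display) (T' : measurableType d') (P' : probability T' R)
  (Z : {RV P' >-> R}) :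
  0 < alpha -> alpha < 1 -> - alpha < theta ->
  (1 <= n)%N -> (1 <= k)%N -> (k <= n)%N ->
  stable_density alpha f ->
  independent_RV Y1 X ->
  has_density_on `]0, +oo[ Y1 (gML_density alpha (theta + n%:R) f) ->
  has_density_on `]0, 1[ X
    (Beta_density (theta / alpha + k%:R) (n%:R / alpha - k%:R)) ->
  has_density_on `]0, +oo[ Z (Z_density alpha theta n k f) ->
  forall t : R,
    [/\ cvg (series (G_term alpha theta n k t) @ \oo),
        char_fun P' Z t = G_fun alpha theta n k t &
        char_fun P (fun w => Y1 w * X w) t = G_fun alpha theta n k t].
Proof.
move=> al0 al1 altheta n1 k1 kn sf YX dY dX dZ t.
have R1 (m : nat) : (1 <= m)%N -> 1 <= m%:R :> R by rewrite -(ler_nat R).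
have [nR kR] := (R1 _ n1, R1 _ k1).
have knR : k%:R <= n%:R :> R by rewrite ler_nat.
set a := theta / alpha + k%:R in dX *; set b := n%:R / alpha - k%:R in dX *.
have aE : (theta + k%:R * alpha) / alpha = a by rewrite /a; field; rewrite gt_eqF.
have a0 : 0 < a.
  rewrite -aE divr_gt0//; have : alpha <= k%:R * alpha by rewrite ler_peMl// ltW.
  lra.
have eta0 : 0 < theta + n%:R by lra.
(* k alpha < k <= n, which makes both n / alpha - k and n - k alpha positive. *)
have kna : k%:R * alpha < n%:R.
  by rewrite (lt_le_trans _ knR)// gtr_pMr// (lt_le_trans ltr01).
have b0 : 0 < b by rewrite subr_gt0 ltr_pdivlMr.
have c0 : 0 < n%:R - k%:R * alpha by rewrite subr_gt0.
(* This identity matches the Gamma values at (theta + n) / alpha and (theta + n) / alpha + r in the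
   moments of Y1 and of X, where they cancel. *)
have abE : a + b = (theta + n%:R) / alpha.
  by rewrite /a /b; field; rewrite gt_eqF.
have mnorm r : measurable_fun [set: R] (fun x : R => `|x| ^+ r).
  by apply: measurable_funX; exact: normr_measurable.
have norm0 r (x : R) : 0 <= `|x| ^+ r by rewrite exprn_ge0.
have er0 r : 0 < theta + n%:R + r%:R * alpha.
  by rewrite ltr_pwDl// mulr_ge0// ltW.
have ear0 r : 0 < (theta + n%:R) / alpha + r%:R.
  by rewrite ltr_pwDl// divr_gt0.
have cvgZ : series (G_term alpha theta n k t) @ \oo --> (char_fun P' Z t : R[i]^o).
  apply: char_fun_moments => //; rewrite ?aE//.
    apply: filterS (has_density_on_ae _ dZ) => // w /=.
    by rewrite in_itv/= andbT => /ltW.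
  move=> r; rewrite (has_density_on_integral _ dZ (mnorm r) (norm0 r))//.
  rewrite Z_density_moment//; last by case: dZ.
  by rewrite /poch GammaE -/a invf_div.
have cvgH : series (G_term alpha theta n k t) @ \oo -->
    (char_fun P (fun w => Y1 w * X w) t : R[i]^o).
  apply: char_fun_moments => //; rewrite ?aE//.
  - exact: measurable_funM.
  - have Y0 : {ae P, forall w, `]0, +oo[%classic (Y1 w)}.
      exact: has_density_on_ae dY.
    have X0 : {ae P, forall w, `]0, 1[%classic (X w)}.
      exact: has_density_on_ae dX.
    apply: filterS2 Y0 X0 => w /=; rewrite !in_itv/= andbT => Yw /andP[Xw _].
    by rewrite mulr_ge0// ltW.
  move=> r; under eq_integral do rewrite normrM exprMn.
  rewrite (independent_RV_integralM YX (mnorm r) (mnorm r))//.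
  rewrite (has_density_on_integral _ dY (mnorm r) (norm0 r))//.
  rewrite (has_density_on_integral _ dX (mnorm r) (norm0 r))//.
  rewrite gML_moment// Beta_moment// abE -EFinM /poch GammaE; congr EFin.
  have := ear0 r; have : 0 < (theta + n%:R) / alpha by rewrite divr_gt0.
  by move=> ? ?; field; rewrite !gt_eqF ?gamma_gt0.
have GZ : G_fun alpha theta n k t = char_fun P' Z t by exact: cvg_lim cvgZ.
have GH : G_fun alpha theta n k t = char_fun P (fun w => Y1 w * X w) t.
  exact: cvg_lim cvgH.
split; [exact: cvgP cvgZ|by rewrite GZ|by rewrite GH].
Qed.
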